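(* Let $n\ge1$, $m\ge1$, $V=\mathbb{R}^{2n}$ with its standard symplectic form $\omega$, and let $G=\mathrm{Sp}(2n,\mathbb{R})$ act diagonally on $V^{\times m}$. Let $\mathcal{A}_G^m$ be the algebra of $G$-invariant real polynomial functions on $V^{\times m}$. Then $\mathcal{A}_G^m$ is generated by $\boldsymbol a=\{a_{ij}:1\le i<j\le m\}$ with syzygies $\boldsymbol b=\{b_{i_1\dots i_{2n+2}}:1\le i_1<\dots<i_{2n+2}\le m\}$, i.e. $$\mathcal{A}_G^m=\langle \boldsymbol a\,|\,\boldsymbol b\rangle .$$ In other words, the $\mathbb{R}$-algebra homomorphism from the free commutative (polynomial) algebra $\mathbb{R}[\boldsymbol a]$ on symbols $a_{ij}$ ($1\le i<j\le m$) to $\mathcal{A}_G^m$ sending each symbol $a_{ij}$ to the function $a_{ij}$ is surjective, and its kernel is the ideal generated by the Pfaffians $b_{i_1\dots i_{2n+2}}$.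
   Context: $V=\mathbb{R}^{2n}$ has coordinates $(x^1,\dots,x^n,y^1,\dots,y^n)$ and $\omega=dx^1\wedge dy^1+\dots+dx^n\wedge dy^n$. A point of $V^{\times m}$ is an $m$-tuple $(A_1,\dots,A_m)$, where $A_i$ has coordinates $(x_i^k,y_i^k)_{k=1}^n$. The functions $a_{ij}$ on $V^{\times m}$ are $a_{ij}=\omega(A_i,A_j)=\sum_{k=1}^n (x_i^k y_j^k-x_j^k y_i^k)$, so $a_{ji}=-a_{ij}$, $a_{ii}=0$; the same conventions are used for the symbols $a_{ij}$. For $1\le i_1<\dots<i_{2n+2}\le m$, $b_{i_1\dots i_{2n+2}}=\mathrm{Pf}\,(a_{i_pi_q})_{1\le p,q\le 2n+2}\in\mathbb{R}[\boldsymbol a]$ is the Pfaffian of the skew-symmetric $(2n+2)\times(2n+2)$ matrix with entries $a_{i_pi_q}$ (for $n=1$: $b_{1234}=a_{12}a_{34}-a_{13}a_{24}+a_{14}a_{23}$). If $m<2n+2$, the set $\boldsymbol b$ is empty. The notation $\langle\boldsymbol a\,|\,\boldsymbol b\rangle$ denotes the commutative $\mathbb{R}$-algebra with generators $\boldsymbol a$ and relations $\boldsymbol b$. *)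

(* Defs.v *)
From HB Require Import structures.
From mathcomp Require Import all_boot all_order all_fingroup all_algebra.
From mathcomp Require Import mpoly.
From mathcomp Require Import boolp classical_sets functions reals.

Set Implicit Arguments.
Unset Strict Implicit.
Unset Printing Implicit Defensive.

Import Order.TTheory GRing.Theory Num.Theory.
Local Open Scope ring_scope.

Section Pfaffian.
Variable r : nat.

Lemma evn_subproof (k : 'I_r) : (k.*2 < r.*2)%N.
Proof. by rewrite ltn_double. Qed.

Lemma odd_subproof (k : 'I_r) : (k.*2.+1 < r.*2)%N.
Proof. by rewrite ltn_Sdouble. Qed.

Definition evn_ord (k : 'I_r) : 'I_(r.*2) := Ordinal (evn_subproof k).
Definition odd_ord (k : 'I_r) : 'I_(r.*2) := Ordinal (odd_subproof k).

(* Pf M = (2^r r!)^-1 \sum_s sgn(s) \prod_(k < r) M_(s(2k), s(2k+1)) with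
   0-based indices; meaningful for skew-symmetric M *)
Definition pfaffian (R : numFieldType) (S : comAlgType R)
    (M : 'M[S]_(r.*2)) : S :=
  ((2 ^ r * r`!)%N%:R^-1 : R) *:
    \sum_(s : 'S_(r.*2))
      (-1) ^+ s * \prod_(k < r) M (s (evn_ord k)) (s (odd_ord k)).

End Pfaffian.

Definition in_ideal_gen (S : comNzRingType) (B : S -> Prop) (x : S) : Prop :=
  exists (k : nat) (c b : 'I_k -> S),
    (forall l, B (b l)) /\ x = \sum_(l < k) c l * b l.

(* coordinates 0, ..., n-1 of a vector are x^1, ..., x^n and coordinates
   n, ..., 2n-1 are y^1, ..., y^n *)
Definition omega (R : realType) (n : nat) (u v : 'cV[R]_(n + n)) : R :=
  \sum_(k < n) (u (lshift n k) 0 * v (rshift n k) 0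
                - v (lshift n k) 0 * u (rshift n k) 0).

Definition symplectic (R : realType) (n : nat) (g : 'M[R]_(n + n)) : Prop :=
  g \in unitmx /\ forall u v, omega (g *m u) (g *m v) = omega u v.

Definition config (R : realType) (n m : nat) := 'I_m -> 'cV[R]_(n + n).

(* a pointed domain is what makes the ring of functions config -> R a
   (nontrivial) comNzRingType *)
HB.instance Definition _ (R : realType) (n m : nat) :=
  Choice.copy (config R n m) ('I_m -> 'cV[R]_(n + n)).
HB.instance Definition _ (R : realType) (n m : nat) :=
  isPointed.Build (config R n m) (fun=> 0).

Definition diag_act (R : realType) (n m : nat) (g : 'M[R]_(n + n))
  (A : config R n m) : config R n m := fun i => g *m A i.

Definition coords (R : realType) (n m : nat) (A : config R n m) :
    'I_(m * (n + n)) -> R :=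
  mxvec (\matrix_(i < m, k < n + n) A i k 0) 0.

Definition polynomial_fun (R : realType) (n m : nat) (f : config R n m -> R) :
    Prop :=
  exists p : {mpoly R[m * (n + n)]}, forall A, f A = p.@[coords A].

Definition invariant_fun (R : realType) (n m : nat) (f : config R n m -> R) :
    Prop :=
  forall g, symplectic g -> forall A, f (diag_act g A) = f A.

Section InvariantAlgebra.
Variables (R : realType) (n m : nat).

Definition inv_pred : {pred config R n m -> R^o} :=
  fun f => `[< polynomial_fun f /\ invariant_fun f >].

Lemma inv_predP f :
  reflect (polynomial_fun f /\ invariant_fun f) (f \in inv_pred).
Proof. exact: asboolP. Qed.

Lemma inv_pred_subring : subring_closed inv_pred.
Proof.
split.
- apply/inv_predP; split=> //.
  by exists 1 => A; rewrite meval1.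
- move=> f g /inv_predP[[p fE] fI] /inv_predP[[q gE] gI].
  apply/inv_predP; split.
    by exists (p - q) => A; rewrite mevalB -fE -gE.
  by move=> h hS A; rewrite /= /GRing.add /GRing.opp /= fI // gI.
- move=> f g /inv_predP[[p fE] fI] /inv_predP[[q gE] gI].
  apply/inv_predP; split.
    by exists (p * q) => A; rewrite mevalM -fE -gE.
  by move=> h hS A; rewrite /= /GRing.mul /= fI // gI.
Qed.

HB.instance Definition _ :=
  GRing.isSubringClosed.Build (config R n m -> R^o) inv_pred inv_pred_subring.

Lemma inv_pred_scale : GRing.scaler_closed inv_pred.
Proof.
move=> c f /inv_predP[[p fE] fI]; apply/inv_predP; split.
  by exists (c *: p) => A; rewrite mevalZ -fE.
by move=> h hS A; rewrite /= /GRing.scale /= fI.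
Qed.

HB.instance Definition _ :=
  GRing.isScaleClosed.Build R (config R n m -> R^o) inv_pred inv_pred_scale.

(* the algebra of Sp(2n, R)-invariant polynomial functions on V^m, with
   pointwise operations *)
Record inv_alg := InvAlg
  { inv_val :> config R n m -> R^o; inv_valP : inv_val \in inv_pred }.

HB.instance Definition _ := [isSub for inv_val].
HB.instance Definition _ := [Choice of inv_alg by <:].
HB.instance Definition _ := [SubChoice_isSubComNzRing of inv_alg by <:].
HB.instance Definition _ := [SubZmodule_isSubLmodule of inv_alg by <:].

Lemma inv_alg_scalerAl (c : R) (f g : inv_alg) : c *: (f * g) = (c *: f) * g.
Proof. by apply/val_inj/funext => A; exact: mulrA. Qed.

HB.instance Definition _ :=
  GRing.LSemiModule_isLSemiAlgebra.Build R inv_alg inv_alg_scalerAl.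
HB.instance Definition _ := GRing.Lalgebra_isComAlgebra.Build R inv_alg.

Definition a_fun (i j : 'I_m) : config R n m -> R :=
  fun A => omega (A i) (A j).

Lemma a_fun_inv i j : a_fun i j \in inv_pred.
Proof.
apply/inv_predP; split; last by move=> g [_ gS] A; exact: gS.
pose x h k : {mpoly R[m * (n + n)]} := 'X_(mxvec_index h k).
exists (\sum_(k < n) (x i (lshift n k) * x j (rshift n k)
                     - x j (lshift n k) * x i (rshift n k))) => A.
rewrite rmorph_sum; apply: eq_bigr => k _ /=.
by rewrite mevalB !mevalM !mevalXU /coords !mxvecE !mxE.
Qed.

Definition a_inv (i j : 'I_m) : inv_alg := InvAlg (a_fun_inv i j).

End InvariantAlgebra.

Definition symbol (m : nat) := {p : 'I_m * 'I_m | (p.1 < p.2)%N}.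

(* the polynomial algebra R[a] on the symbols a_ij, i < j *)
Notation symb_alg R m := {mpoly R[#|{: symbol m}|]}.

Section Symbols.
Variables (R : realType) (m : nat).

(* the symbol a_ij, with the conventions a_ji = - a_ij and a_ii = 0 *)
Definition a_sym (i j : 'I_m) : symb_alg R m :=
  if (insub (i, j) : option (symbol m)) is Some p then 'X_(enum_rank p)
  else if (insub (j, i) : option (symbol m)) is Some p then - 'X_(enum_rank p)
  else 0.

Definition b_pfaff (n : nat) (s : 'I_(n.+1.*2) -> 'I_m) : symb_alg R m :=
  pfaffian (\matrix_(p, q) a_sym (s p) (s q)).

Definition b_rel (n : nat) (b : symb_alg R m) : Prop :=
  exists s : 'I_(n.+1.*2) -> 'I_m,
    (forall p q : 'I_(n.+1.*2), (p < q)%N -> (s p < s q)%N) /\ b = b_pfaff s.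

End Symbols.

(* Main.v *)
Require Import Defs.
From HB Require Import structures.
From mathcomp Require Import all_boot all_order all_fingroup all_algebra.
From mathcomp Require Import mpoly.
From mathcomp Require Import boolp functions reals.
From mathcomp Require Import ring zify.

(** Surjectivity.  The infinitesimal form of invariance says that the
    polarization operators W_rs = sum_i y_i^r d/dz_i^s (with y the symplectic
    dual coordinates) satisfy W_rs f = - W_sr f.  For the Fischer inner product,
    in which multiplication by a variable is adjoint to its derivative,
    comparing the Casimir operators of gl and sp gives
      sum |W_rs f|^2 + sum |d f/dz_i^s|^2 = - sum_ij <f, a_ji Omega_ij f>
    where Omega_ij f is an invariant of lower degree, hence by induction a
    polynomial in the a_ij.  If f is orthogonal to the polynomials in the a_ij
    the right-hand side vanishes, so f is constant.

    Kernel.  Polarization reduces to multilinear relations, i.e. to linear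
    combinations of perfect matchings of ordered points.  The Pfaffian relation
    on the end points of n+1 nested arcs rewrites a matching into
    lexicographically smaller ones.  A matching without n+1 nested arcs is
    recovered from the word that labels its arcs by nesting depth: it is the
    lexicographically least matching compatible with this word.  Evaluating at
    the corresponding basis vectors shows that such matchings are independent. *)

Set Implicit Arguments.
Unset Strict Implicit.
Unset Printing Implicit Defensive.

Import Order.TTheory GRing.Theory Num.Theory.
Local Open Scope ring_scope.

(** * Blocks of two points *)

Section Blocks.
Variable r : nat.
Implicit Types (i : 'I_(r.*2)) (k l : 'I_r).

Lemma half_subproof i : (i./2 < r)%N.
Proof. by rewrite ltn_half_double. Qed.

Definition half_ord i : 'I_r := Ordinal (half_subproof i).

Definition swap_fun i : 'I_(r.*2) :=
  if odd i then evn_ord (half_ord i) else odd_ord (half_ord i).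

Lemma half_evn k : half_ord (evn_ord k) = k.
Proof. by apply: val_inj; rewrite /= doubleK. Qed.

Lemma half_odd k : half_ord (odd_ord k) = k.
Proof. by apply: val_inj; rewrite /= uphalf_double. Qed.

Lemma swap_fun_evn k : swap_fun (evn_ord k) = odd_ord k.
Proof. by rewrite /swap_fun /= odd_double half_evn. Qed.

Lemma swap_fun_odd k : swap_fun (odd_ord k) = evn_ord k.
Proof. by rewrite /swap_fun /= odd_double half_odd. Qed.

Variant ord_double_spec : 'I_(r.*2) -> bool -> Type :=
  | OrdEvn k : ord_double_spec (evn_ord k) false
  | OrdOdd k : ord_double_spec (odd_ord k) true.

Lemma ord_doubleP i : ord_double_spec i (odd i).
Proof.
have iE : val i = (odd i + (half_ord i).*2)%N by rewrite odd_double_half.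
case: (boolP (odd i)) iE => _ iE.
- by rewrite (_ : i = odd_ord (half_ord i)) //; [right|apply: val_inj].
- by rewrite (_ : i = evn_ord (half_ord i)) //; [left|apply: val_inj].
Qed.

Lemma swap_funK : involutive swap_fun.
Proof. by move=> i; case: (ord_doubleP i) => k; rewrite !(swap_fun_evn, swap_fun_odd). Qed.

(** The standard perfect matching as a fixed-point-free involution. The conjugate [swap ^ s] joins
    [s (evn_ord k)] to [s (odd_ord k)], hence is the matching read off from [s]. *)
Definition swap : {perm 'I_(r.*2)} := perm (inv_inj swap_funK).

Lemma swap_evn k : swap (evn_ord k) = odd_ord k.
Proof. by rewrite permE swap_fun_evn. Qed.

Lemma swap_odd k : swap (odd_ord k) = evn_ord k.
Proof. by rewrite permE swap_fun_odd. Qed.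

Lemma swapK : involutive swap.
Proof. by move=> i; rewrite !permE swap_funK. Qed.

Lemma odd_swap i : odd (swap i) = ~~ odd i.
Proof. by case: (ord_doubleP i) => k; rewrite (swap_evn, swap_odd) /= odd_double. Qed.

Lemma swap_neq i : swap i != i.
Proof. by apply/negP => /eqP/(congr1 (odd \o val)) /=; rewrite odd_swap; case: odd. Qed.

Lemma ltn_swap i : (i < swap i)%N = ~~ odd i.
Proof.
case: (ord_doubleP i) => k; rewrite (swap_evn, swap_odd) /= ?odd_double; lia.
Qed.

Lemma big_evn (T : Type) (idx : T) (op : Monoid.com_law idx) (F : 'I_(r.*2) -> T) :
  \big[op/idx]_(i < r.*2 | ~~ odd i) F i = \big[op/idx]_k F (evn_ord k).
Proof.
rewrite (reindex (@evn_ord r)).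
  by apply: eq_bigl => k /=; rewrite odd_double.
exists half_ord => [k _|i]; first exact: half_evn.
by rewrite inE; case: (ord_doubleP i) => // k _; rewrite half_evn.
Qed.

Lemma big_pairs (T : Type) (idx : T) (op : Monoid.com_law idx) (F : 'I_(r.*2) -> T) :
  \big[op/idx]_i F i = \big[op/idx]_k op (F (evn_ord k)) (F (odd_ord k)).
Proof.
rewrite big_split (bigID (fun i : 'I_(r.*2) => ~~ odd i)) /= big_evn; congr (op _ _).
rewrite (reindex_inj (@perm_inj _ swap)) /=.
rewrite (eq_bigl (fun i : 'I_(r.*2) => ~~ odd i)) => [|i]; last by rewrite odd_swap !negbK.
by rewrite big_evn; apply: eq_bigr => k _; rewrite swap_evn.
Qed.

Lemma prod_sum_pairs (S : comNzRingType) (T : finType) (G : 'I_r -> T -> T -> S) :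
  \prod_k (\sum_p \sum_q G k p q) =
  \sum_(e : {ffun 'I_(r.*2) -> T}) \prod_k G k (e (evn_ord k)) (e (odd_ord k)).
Proof.
under eq_bigr do rewrite pair_big /=.
rewrite bigA_distr_bigA /=.
rewrite (reindex (fun e : {ffun 'I_(r.*2) -> T} =>
  [ffun k => (e (evn_ord k), e (odd_ord k))])) /=.
  by apply: eq_bigr => e _; apply: eq_bigr => k _; rewrite ffunE.
exists (fun f : {ffun 'I_r -> T * T} =>
   [ffun i : 'I_(r.*2) => if odd i then (f (half_ord i)).2 else (f (half_ord i)).1]).
- move=> e _; apply/ffunP => i; rewrite !ffunE.
  by case: (ord_doubleP i) => k; rewrite ?half_evn ?half_odd.
- move=> f _; apply/ffunP => k; rewrite !ffunE /= odd_double /= half_evn half_odd.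
  by case: (f k).
Qed.

(* a parity-preserving [tau] is the product of its restriction to the even
   points and of the conjugate of this restriction by [swap] *)
Lemma sign_parity_perm (tau : {perm 'I_(r.*2)}) :
  (forall i, tau (swap i) = swap (tau i)) -> (forall k, ~~ odd (tau (evn_ord k))) ->
  odd_perm tau = false.
Proof.
move=> tauC tauE.
have odd_tau i : odd (tau i) = odd i.
  case: (ord_doubleP i) => k; first exact/negbTE/tauE.
  by rewrite -swap_evn tauC odd_swap tauE.
pose f i := if odd i then i else tau i.
have f_inj : injective f.
  move=> i j; rewrite /f; case: ifPn => oi; case: ifPn => oj //.
  - by move=> E; move: oi; rewrite E odd_tau (negbTE oj).
  - by move=> E; move: oj; rewrite -E odd_tau (negbTE oi).
  - exact: perm_inj.
have -> : tau = (perm f_inj * perm f_inj ^ swap)%g.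
  apply/permP => i; rewrite permM.
  have swapV j : (swap^-1)%g j = swap j by apply: (@perm_inj _ swap); rewrite permKV swapK.
  have fE j : perm f_inj j = f j by rewrite permE.
  rewrite conjgE !permM swapV !fE /f.
  case: (boolP (odd i)) => oi.
    by rewrite odd_swap oi /= tauC swapK.
  by rewrite odd_swap odd_tau oi /= swapK.
by rewrite odd_permM odd_permJ addbb.
Qed.

Lemma tperm_evn_out k l : l != k -> tperm (evn_ord k) (odd_ord k) (evn_ord l) = evn_ord l.
Proof. by move=> lk; rewrite tpermD // -val_eqE /=; move: lk; rewrite -val_eqE /=; lia. Qed.

Lemma tperm_odd_out k l : l != k -> tperm (evn_ord k) (odd_ord k) (odd_ord l) = odd_ord l.
Proof. by move=> lk; rewrite tpermD // -val_eqE /=; move: lk; rewrite -val_eqE /=; lia. Qed.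

(** Induction on the number of blocks that [tau] reverses. Composing with the transposition of such
    a block changes the sign and lowers the count; with no reversed block left, [sign_parity_perm]
    applies. *)
Lemma sign_block_perm (S : comPzRingType) (tau : {perm 'I_(r.*2)}) :
  (forall i, tau (swap i) = swap (tau i)) ->
  (-1) ^+ tau = \prod_k (-1) ^+ odd (tau (evn_ord k)) :> S.
Proof.
have [c] := ubnP #|[pred k | odd (tau (evn_ord k))]|.
elim: c tau => // c IH tau; rewrite ltnS => le_c tauC.
have [k ok|all_even] := pickP [pred k | odd (tau (evn_ord k))]; last first.
  have tauE k : ~~ odd (tau (evn_ord k)) by have /= -> := all_even k.
  rewrite sign_parity_perm // big1 // => k _.
  by rewrite (negbTE (tauE k)).
have ok' : odd (tau (evn_ord k)) := ok.
pose t := (tperm (evn_ord k) (odd_ord k) * tau)%g.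
have tk : t (evn_ord k) = swap (tau (evn_ord k)).
  by rewrite permM tpermL -swap_evn tauC.
have tl l : l != k -> t (evn_ord l) = tau (evn_ord l). by move=> lk; rewrite permM tperm_evn_out.
have tC i : t (swap i) = swap (t i).
  rewrite !permM -tauC; congr (tau _).
  case: (ord_doubleP i) => l; rewrite ?swap_evn ?swap_odd; have [->|lk] := eqVneq l k.
  - by rewrite tpermL tpermR swap_odd.
  - by rewrite tperm_evn_out // tperm_odd_out // swap_evn.
  - by rewrite tpermL tpermR swap_evn.
  - by rewrite tperm_evn_out // tperm_odd_out // swap_odd.
have tauE : tau = (tperm (evn_ord k) (odd_ord k) * t)%g.
  by rewrite /t mulgA tperm2 mul1g.
rewrite tauE odd_permM odd_tperm -val_eqE /= ltn_eqF ?ltnSn //= signrN.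
rewrite (IH t) //; last first.
  apply: leq_trans le_c; rewrite [X in (_ < X)%N](cardD1 k) inE ok' add1n ltnS.
  apply: subset_leq_card; apply/subsetP => l; rewrite !inE.
  have [->|lk] := eqVneq l k; first by rewrite tk odd_swap ok'.
  by rewrite tl.
rewrite (bigD1 k) // [in RHS](bigD1 k) //= -tauE tk odd_swap ok' /= expr0 mul1r expr1 mulN1r.
by congr (- _); apply: eq_bigr => l lk; rewrite tl.
Qed.

End Blocks.

(** * Pfaffians and the symplectic form *)

Section Ideal.
Variables (S : comNzRingType) (B : S -> Prop).

Lemma ideal_gen0 : in_ideal_gen B 0.
Proof. by exists 0, (fun=> 0), (fun=> 0); split=> [[]|] //; rewrite big_ord0. Qed.

Lemma ideal_gen_sub x : B x -> in_ideal_gen B x.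
Proof.
by move=> Bx; exists 1, (fun=> 1), (fun=> x); split=> //; rewrite big_ord1 mul1r.
Qed.

Lemma ideal_genD x y : in_ideal_gen B x -> in_ideal_gen B y -> in_ideal_gen B (x + y).
Proof.
move=> [k [c [b [Bb ->]]]] [l [c' [b' [Bb' ->]]]].
exists (k + l)%N, (fun i : 'I_(k + l) => match fintype.split i with inl j => c j | inr j => c' j end).
exists (fun i : 'I_(k + l) => match fintype.split i with inl j => b j | inr j => b' j end).
split=> [i|]; first by case: (fintype.split i).
rewrite big_split_ord; congr (_ + _); apply: eq_bigr => i _.
- by rewrite (unsplitK (inl _ i)).
- by rewrite (unsplitK (inr _ i)).
Qed.

Lemma ideal_genM x y : in_ideal_gen B y -> in_ideal_gen B (x * y).
Proof.
move=> [k [c [b [Bb ->]]]]; exists k, (fun i => x * c i), b; split=> //.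
by rewrite mulr_sumr; apply: eq_bigr => i _; rewrite mulrA.
Qed.

Lemma ideal_gen_sum (I : Type) (s : seq I) (P : pred I) (F : I -> S) :
  (forall i, P i -> in_ideal_gen B (F i)) -> in_ideal_gen B (\sum_(i <- s | P i) F i).
Proof. by move=> BF; apply: big_ind => //; [exact: ideal_gen0|exact: ideal_genD]. Qed.

End Ideal.

Section PfaffianSum.
Variables (r : nat) (S : comNzRingType).

(** The Pfaffian without its factor 1/(2^r r!), so that it makes sense over any commutative ring and
    commutes with ring morphisms. *)
Definition pfsum (M : 'I_(r.*2) -> 'I_(r.*2) -> S) : S :=
  \sum_(s : 'S_(r.*2)) (-1) ^+ s * \prod_k M (s (evn_ord k)) (s (odd_ord k)).

Lemma pfsum_perm (rho : 'S_(r.*2)) M :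
  pfsum (fun p q => M (rho p) (rho q)) = (-1) ^+ rho * pfsum M.
Proof.
rewrite /pfsum mulr_sumr [RHS](reindex_inj (mulIg rho)); apply: eq_bigr => s _ /=.
rewrite mulrA -signr_addb odd_permM addbC addbK; congr (_ * _).
by apply: eq_bigr => k _; rewrite !permM.
Qed.

(** The terms of [s] and [s * t], with [t] the transposition of [p] and [q], have equal products and
    opposite signs. *)
Lemma pfsum_alternate M p q : p != q ->
  (forall i, M p i = M q i) -> (forall i, M i p = M i q) -> pfsum M = 0.
Proof.
move=> pq Mr Mc; pose t := tperm p q.
have Mt i j : M (t i) (t j) = M i j.
  by rewrite /t; case: tpermP => [->|->|_ _]; case: tpermP => [->|->|_ _];
     rewrite ?Mr ?Mc.
rewrite /pfsum (bigID (@odd_perm _)) /= (reindex_inj (mulIg t)) /=.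
under eq_bigl do rewrite odd_permM odd_tperm pq addbT.
rewrite -big_split big1 //= => s os.
rewrite odd_permM odd_tperm pq addbT (negbTE os) expr0 expr1 mul1r mulN1r.
by rewrite [X in _ + X](eq_bigr (fun k => M ((s * t)%g (evn_ord k)) ((s * t)%g (odd_ord k))))
  ?addNr // => k _; rewrite !permM Mt.
Qed.

End PfaffianSum.

Lemma pfaffianE (R : numFieldType) (S : comAlgType R) r (M : 'M[S]_(r.*2)) :
  pfaffian M = ((2 ^ r * r`!)%N%:R^-1 : R) *: pfsum M.
Proof. by []. Qed.

Lemma pfsumE (R : numFieldType) (S : comAlgType R) r (M : 'M[S]_(r.*2)) :
  pfsum M = ((2 ^ r * r`!)%N%:R : R) *: pfaffian M.
Proof.
rewrite pfaffianE scalerA mulfV ?scale1r // pnatr_eq0 -lt0n.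
by rewrite muln_gt0 expn_gt0 fact_gt0.
Qed.

Lemma rmorph_pfsum (S S' : comNzRingType) (f : {rmorphism S -> S'}) r
    (M : 'I_(r.*2) -> 'I_(r.*2) -> S) :
  f (pfsum M) = pfsum (fun p q => f (M p q)).
Proof.
rewrite rmorph_sum; apply: eq_bigr => s _.
by rewrite rmorphM rmorph_sign rmorph_prod.
Qed.

Lemma sort_ord_inj K m (s : 'I_K -> 'I_m) : injective s ->
  exists rho : 'S_K, forall p q : 'I_K, (p < q)%N -> (s (rho p) < s (rho q))%N.
Proof.
move=> s_inj; pose A p := [set q | (s q < s p)%N].
have Alt p : (#|A p| < K)%N.
  rewrite -[X in (_ < X)%N]card_ord -cardsT; apply: proper_card.
  by apply/properP; split; [exact: subsetT | exists p; rewrite ?inE ?ltnn].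
have Amono p q : (s p < s q)%N -> (#|A p| < #|A q|)%N.
  move=> pq; apply: proper_card; apply/properP; split.
    by apply/subsetP => i; rewrite !inE => /ltn_trans; apply.
  by exists p; rewrite !inE ?ltnn.
(* The rank counts the points with a smaller image; the inverse of this permutation sorts [s]. *)
pose rk p := Ordinal (Alt p).
have rk_inj : injective rk.
  move=> p q /(congr1 val) /= E; apply/s_inj/val_inj/eqP.
  by case: ltngtP => // /Amono; rewrite E ltnn.
exists (perm rk_inj)^-1%g => p q pq.
have rkK i : rk ((perm rk_inj)^-1%g i) = i by rewrite -[rk _](permE rk_inj) permKV.
rewrite ltnNge leq_eqVlt; apply/negP => /orP[/eqP/val_inj/s_inj E|/Amono].
  by move: pq; rewrite -(rkK p) -E rkK ltnn.
have := congr1 val (rkK p); have := congr1 val (rkK q) => /= -> ->.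
by rewrite ltnNge ltnW.
Qed.

(** Reduces arbitrary labels to the increasing ones of [b_rel]: a repeated label gives zero, and
    distinct labels are sorted at the cost of a sign. *)
Lemma pfsum_ideal (R : realType) m n (s : 'I_(n.+1.*2) -> 'I_m) :
  in_ideal_gen (@b_rel R m n) (pfsum (fun p q => a_sym R (s p) (s q))).
Proof.
have [/injectiveP s_inj|/injectivePn[p [q pq spq]]] := boolP (injectiveb s); last first.
  rewrite (@pfsum_alternate _ _ _ p q) //; first exact: ideal_gen0.
  - by move=> i; rewrite spq.
  - by move=> i; rewrite spq.
have [rho rhoP] := sort_ord_inj s_inj.
have -> : pfsum (fun p q => a_sym R (s p) (s q)) =
    (-1) ^+ rho * pfsum (fun p q => a_sym R (s (rho p)) (s (rho q))).
  by rewrite (pfsum_perm rho (fun p q => a_sym R (s p) (s q))) mulrA -signr_addb addbb mul1r.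
have -> : pfsum (fun p q => a_sym R (s (rho p)) (s (rho q))) =
    pfsum (\matrix_(p, q) a_sym R (s (rho p)) (s (rho q))).
  by apply: eq_bigr => t _; congr (_ * _); apply: eq_bigr => k _; rewrite mxE.
rewrite (@pfsumE R (symb_alg R m)) -mul_mpolyC; do 2!apply: ideal_genM.
by apply: ideal_gen_sub; exists (s \o rho).
Qed.

(** * The symplectic form in coordinates *)

Section Omega.
Variables (R : realType) (n : nat).
Implicit Types (u v w : 'cV[R]_(n + n)) (p q : 'I_(n + n)).

Definition symp_mx p q : R :=
  match fintype.split p, fintype.split q with
  | inl k, inr l => (k == l)%:R
  | inr k, inl l => - (k == l)%:R
  | _, _ => 0
  end.

Lemma symp_ll (k l : 'I_n) : symp_mx (lshift n k) (lshift n l) = 0.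
Proof. by rewrite /symp_mx (unsplitK (inl _ k)) (unsplitK (inl _ l)). Qed.
Lemma symp_lr (k l : 'I_n) : symp_mx (lshift n k) (rshift n l) = (k == l)%:R.
Proof. by rewrite /symp_mx (unsplitK (inl _ k)) (unsplitK (inr _ l)). Qed.
Lemma symp_rl (k l : 'I_n) : symp_mx (rshift n k) (lshift n l) = - (k == l)%:R.
Proof. by rewrite /symp_mx (unsplitK (inr _ k)) (unsplitK (inl _ l)). Qed.
Lemma symp_rr (k l : 'I_n) : symp_mx (rshift n k) (rshift n l) = 0.
Proof. by rewrite /symp_mx (unsplitK (inr _ k)) (unsplitK (inr _ l)). Qed.
Definition sympE := (symp_ll, symp_lr, symp_rl, symp_rr).

Lemma symp_skew p q : symp_mx p q = - symp_mx q p.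
Proof.
by case: (split_ordP p) => k ->; case: (split_ordP q) => l ->;
   rewrite !sympE ?oppr0 ?opprK // eq_sym.
Qed.

Lemma sum_delta (V : zmodType) (I : finType) (i0 : I) (F : I -> V) :
  \sum_i F i *+ (i == i0) = F i0.
Proof.
rewrite (bigD1 i0) //= eqxx mulr1n big1 ?addr0 // => i /negbTE ->.
by rewrite mulr0n.
Qed.

(** The identity J^T J = 1, which links the symplectic form to the Euclidean structure behind the
    Fischer product. *)
Lemma symp_orth p q : \sum_i symp_mx i p * symp_mx i q = (p == q)%:R.
Proof.
have E (k l : 'I_n) : \sum_(i < n) (i == k)%:R * (i == l)%:R = (k == l)%:R :> R.
  under eq_bigr do rewrite mulrC mulr_natr.
  exact: (sum_delta k (fun i => (i == l)%:R)).
rewrite big_split_ord /=.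
case: (split_ordP p) => k ->; case: (split_ordP q) => l ->;
  under eq_bigr do rewrite !sympE; under [X in _ + X]eq_bigr do rewrite !sympE.
- rewrite big1 ?add0r; last by move=> *; rewrite mulr0.
  under eq_bigr do rewrite mulrNN.
  by rewrite E (inj_eq (@lshift_inj _ _)).
- by rewrite !big1 ?addr0 ?eq_lrshift // => *; rewrite ?mulr0 ?mul0r.
- by rewrite !big1 ?addr0 ?eq_rlshift // => *; rewrite ?mulr0 ?mul0r.
- rewrite [X in _ + X]big1 ?addr0; last by move=> *; rewrite mulr0.
  by rewrite E (inj_eq (@rshift_inj _ _)).
Qed.

Lemma omegaE u v : omega u v = \sum_p \sum_q symp_mx p q * (u p 0 * v q 0).
Proof.
rewrite big_split_ord /= /omega sumrB; congr (_ + _).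
- apply: eq_bigr => k _; rewrite big_split_ord /= big1 ?add0r; last first.
    by move=> l _; rewrite sympE mul0r.
  rewrite -[LHS](sum_delta k (fun l => u (lshift n k) 0 * v (rshift n l) 0)).
  by apply: eq_bigr => l _; rewrite sympE mulr_natl eq_sym.
- rewrite -sumrN; apply: eq_bigr => k _; rewrite big_split_ord /= [X in _ + X]big1 ?addr0; last first.
    by move=> l _; rewrite sympE mul0r.
  rewrite -[LHS](sum_delta k (fun l => - (v (lshift n l) 0 * u (rshift n k) 0))).
  apply: eq_bigr => l _; rewrite sympE mulNr mulr_natl eq_sym mulNrn.
  by rewrite [u _ _ * _]mulrC.
Qed.

Lemma omega_skew u v : omega u v = - omega v u.
Proof. by rewrite -sumrN; apply: eq_bigr => k _; rewrite opprB. Qed.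

Lemma omega_suml (I : finType) (P : pred I) (F : I -> 'cV[R]_(n + n)) v :
  omega (\sum_(i | P i) F i) v = \sum_(i | P i) omega (F i) v.
Proof.
rewrite exchange_big /=; apply: eq_bigr => k _.
by rewrite !summxE mulr_suml mulr_sumr -sumrB.
Qed.

Lemma omega_sumr (I : finType) (P : pred I) (F : I -> 'cV[R]_(n + n)) v :
  omega v (\sum_(i | P i) F i) = \sum_(i | P i) omega v (F i).
Proof.
rewrite omega_skew omega_suml -sumrN.
by apply: eq_bigr => i _; rewrite -omega_skew.
Qed.

Lemma omegaZ a b u v : omega (a *: u) (b *: v) = a * b * omega u v.
Proof. by rewrite mulr_sumr; apply: eq_bigr => k _; rewrite !mxE; ring. Qed.

Lemma omegaDl u v w : omega (u + v) w = omega u w + omega v w.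
Proof. by rewrite -big_split; apply: eq_bigr => k _ /=; rewrite !mxE; ring. Qed.

Lemma omegaDr u v w : omega w (u + v) = omega w u + omega w v.
Proof. by rewrite !(omega_skew w) omegaDl opprD. Qed.

Lemma omegavv v : omega v v = 0.
Proof. by rewrite /omega big1 // => k _; rewrite subrr. Qed.

Lemma omega_delta p q : omega (delta_mx p 0) (delta_mx q 0) = symp_mx p q.
Proof.
rewrite omegaE -[RHS](sum_delta p (fun i => symp_mx i q)).
apply: eq_bigr => i _.
rewrite -(sum_delta q (fun j => symp_mx i j *+ (i == p))); apply: eq_bigr => j _.
by rewrite !mxE !eqxx !andbT -natrM -mulrnA mulr_natr.
Qed.

(* after expanding in coordinates, the antisymmetrization over the points is
   a determinant with more columns than available coordinates *)
Lemma pfsum_gram (v : 'I_(n.+1.*2) -> 'cV[R]_(n + n)) :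
  pfsum (fun i j => omega (v i) (v j)) = 0.
Proof.
rewrite /pfsum; under eq_bigr => s _.
  under [X in _ * X]eq_bigr do rewrite omegaE.
  rewrite (prod_sum_pairs (fun k p q => symp_mx p q *
    (v (s (evn_ord k)) p 0 * v (s (odd_ord k)) q 0))) mulr_sumr; over.
rewrite exchange_big big1 //= => e _.
transitivity (\det (\matrix_(i, j) v j (e i) 0) *
   \prod_k symp_mx (e (evn_ord k)) (e (odd_ord k))).
  rewrite /determinant mulr_suml; apply: eq_bigr => s _.
  rewrite -mulrA; congr (_ * _).
  rewrite big_split mulrC; congr (_ * _).
  by rewrite big_pairs; apply: eq_bigr => k _; rewrite !mxE.
have /injectivePn[i [j ij eij]] : ~~ injectiveb e.
  apply/negP => /injectiveP/leq_card; rewrite !card_ord; lia.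
rewrite (determinant_alternate ij) ?mul0r // => k.
by rewrite !mxE eij.
Qed.

End Omega.

(** * Perfect matchings *)

Section Matchings.
Variable D : nat.
Implicit Types (pi : {perm 'I_D}) (i j : 'I_D).

Definition matching pi := [forall i, (pi (pi i) == i) && (pi i != i)].

Lemma matchingP pi : reflect (involutive pi /\ forall i, pi i != i) (matching pi).
Proof.
apply: (iffP forallP) => [H|[H1 H2] i]; last by rewrite H1 eqxx H2.
by split=> i; have /andP[/eqP] := H i.
Qed.

Lemma matchingJ pi (s : {perm 'I_D}) : matching pi -> matching (pi ^ s)%g.
Proof.
move=> /matchingP[piK pi_neq]; apply/matchingP.
have sE i : i = s ((s^-1)%g i) by rewrite permKV.
split=> i; rewrite (sE i) !permJ ?piK //.
by rewrite (inj_eq perm_inj) pi_neq.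
Qed.

Definition lex_lt pi' pi :=
  [exists j : 'I_D, (pi' j < pi j)%N && [forall i : 'I_D, (i < j)%N ==> (pi' i == pi i)]].

Lemma lex_ltP pi' pi :
  reflect (exists2 j, (pi' j < pi j)%N & forall i, (i < j)%N -> pi' i = pi i)
          (lex_lt pi' pi).
Proof.
apply: (iffP existsP) => [[j /andP[lt_j /forallP H]]|[j lt_j H]]; exists j => //.
  by move=> i ij; apply/eqP; have /implyP := H i; apply.
by rewrite lt_j; apply/forallP => i; apply/implyP => /H ->.
Qed.

Lemma lex_lt_irr pi : lex_lt pi pi = false.
Proof. by apply/negbTE/lex_ltP => -[j]; rewrite ltnn. Qed.

Lemma lex_lt_trans : transitive lex_lt.
Proof.
move=> p2 p1 p3 /lex_ltP[j lt_j Hj] /lex_ltP[k lt_k Hk]; apply/lex_ltP.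
have [jk|kj|jk] := ltngtP j k.
- exists j; first by rewrite -(Hk j jk).
  by move=> i ij; rewrite Hj // Hk // (ltn_trans ij).
- exists k; first by rewrite (Hj k kj).
  by move=> i ik; rewrite Hj ?Hk // (ltn_trans ik).
- have {}jk := val_inj jk; subst k; exists j; first exact: ltn_trans lt_k.
  by move=> i ij; rewrite Hj ?Hk.
Qed.

Lemma first_diff pi' pi : pi' != pi ->
  exists2 j, pi' j != pi j & forall i, (i < j)%N -> pi' i = pi i.
Proof.
move=> ne.
have [j0 j0P] : exists j, pi' j != pi j.
  by apply/existsP; apply: contraR ne => /existsPn H; apply/eqP/permP => i;
     apply/eqP; have := H i; rewrite negbK.
case: (arg_minnP (P := fun j => pi' j != pi j) (@nat_of_ord D) j0P) => j jP jmin.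
by exists j => // i ij; apply/eqP; apply: contraLR ij => /jmin; rewrite -leqNgt.
Qed.

Lemma lex_lt_total pi' pi : pi' != pi -> lex_lt pi' pi || lex_lt pi pi'.
Proof.
move=> /first_diff[j]; rewrite neq_ltn => /orP[lt_j|lt_j] H; apply/orP.
- by left; apply/lex_ltP; exists j.
- by right; apply/lex_ltP; exists j => // i /H.
Qed.

(** Turns the total order [lex_lt] into a natural number that can serve as an induction measure. *)
Definition lex_rank pi := #|[set pi' | lex_lt pi' pi]|.

Lemma lex_rank_lt pi' pi : lex_lt pi' pi -> (lex_rank pi' < lex_rank pi)%N.
Proof.
move=> lt_pi; apply: proper_card; apply/properP; split.
  by apply/subsetP => p; rewrite !inE => /lex_lt_trans; apply.
by exists pi'; rewrite !inE ?lex_lt_irr.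
Qed.

Section Weight.
Variable S : comNzRingType.
Implicit Type al : 'I_D -> 'I_D -> S.

(** Each arc is read from its smaller end point, which fixes the sign when [al] is
    skew-symmetric. *)
Definition wt al pi : S := \prod_(i < D | (i < pi i)%N) al i (pi i).

(** [P] and [Q] each select one point of every arc, and [g] is constant on arcs: [pi] exchanges the
    points in [P] only with the points in [Q] only. *)
Lemma prod_half pi (P Q : pred 'I_D) (g : 'I_D -> S) :
  involutive pi -> (forall i, g (pi i) = g i) ->
  (forall i, P (pi i) = ~~ P i) -> (forall i, Q (pi i) = ~~ Q i) ->
  \prod_(i | P i) g i = \prod_(i | Q i) g i.
Proof.
move=> piK gpi Ppi Qpi.
rewrite (bigID Q) /= [RHS](bigID P) /=; congr (_ * _).
  by apply: eq_bigl => i; rewrite andbC.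
rewrite (reindex_inj (@perm_inj _ pi)); apply: eq_big => i; last by rewrite gpi.
by rewrite Ppi Qpi negbK andbC.
Qed.

Lemma matching_ltn pi i : matching pi -> (pi i < pi (pi i))%N = ~~ (i < pi i)%N.
Proof.
move=> /matchingP[piK pi_neq]; rewrite piK; have := pi_neq i.
by rewrite -val_eqE /=; case: ltngtP.
Qed.

Lemma wtJ al pi (s : {perm 'I_D}) : (forall i j, al i j = - al j i) -> matching pi ->
  wt al (pi ^ s)%g =
  \prod_(i < D | (i < pi i)%N) ((-1) ^+ (s (pi i) < s i)%N * al (s i) (s (pi i))).
Proof.
move=> al_skew mpi; have [piK pi_neq] := matchingP _ mpi.
rewrite /wt (reindex_inj (@perm_inj _ s)) /=.
under eq_bigl do rewrite permJ.
rewrite [LHS](eq_bigr (fun i => (-1) ^+ (s (pi i) < s i)%N * al (s i) (s (pi i)))).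
  apply: (@prod_half pi) => // i; rewrite ?piK.
  - have : s i != s (pi i) by rewrite (inj_eq perm_inj) eq_sym pi_neq.
    rewrite -val_eqE /= => /negbTE ne; case: ltngtP ne => // _ _.
    + by rewrite expr0 expr1 mul1r mulN1r al_skew opprK.
    + by rewrite expr0 expr1 mul1r mulN1r -al_skew.
  - have := matching_ltn ((s i)) (matchingJ s mpi).
    by rewrite !permJ piK.
  - by have := matching_ltn i mpi; rewrite piK.
move=> i lt_i; rewrite permJ ltnNge ltnW //= ?expr0 ?mul1r //.
Qed.

End Weight.

(** * Nesting depth of arcs *)

Section Nesting.
Variable pi : {perm 'I_D}.

(** For an opening [j]: some [k] nested arcs enclose the arc of [j], which is then the innermost of
    k+1. *)
Fixpoint nested_at k j : bool :=
  if k is k'.+1 then [exists i : 'I_D, [&& (i < j)%N, (pi j < pi i)%N & nested_at k' i]]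
  else true.
Arguments nested_at : simpl never.

(** The number of arcs in a longest chain enclosing the arc of an opening [j], capped at [n]. *)
Definition nest_label n j := (\sum_(k < n) nested_at k.+1 j)%N.

Lemma nested_atS k i j : (i < j)%N -> (pi j < pi i)%N -> nested_at k i -> nested_at k.+1 j.
Proof. by move=> ij pij Hi; apply/existsP; exists i; rewrite ij pij. Qed.

(** A chain that encloses the arc of [i], together with this arc, is a longer chain that encloses
    the arc of [j]. The last hypothesis says that the cap [n] is not reached at [i]. *)
Lemma nest_label_lt n i j : (i < j)%N -> (pi j < pi i)%N -> ~~ nested_at n i ->
  (nest_label n i < nest_label n j)%N.
Proof.
move=> ij pij; case: n => [//|n] ni.
rewrite /nest_label big_ord_recr /= (negbTE ni) addn0.
rewrite big_ord_recl -add1n; apply: leq_add.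
  by rewrite (nested_atS (k := 0) ij).
apply: leq_sum => k _; rewrite lift0.
by case: (boolP (nested_at k.+1 i)) => // /(nested_atS ij pij) ->.
Qed.

Lemma nest_label_bound n j : ~~ nested_at n j -> (nest_label n j < n)%N.
Proof.
case: n => // n nj; rewrite /nest_label big_ord_recr /= (negbTE nj).
rewrite addn0 ltnS -[X in (_ <= X)%N]card_ord -sum1_card.
by apply: leq_sum => k _; case: nested_at.
Qed.

(** Unfolds the recursion into explicit arcs, from the outermost one at [p 0] to the one at
    [p k = j]; values of [p] beyond [k] carry no information. *)
Lemma nested_chain k j : (j < pi j)%N -> nested_at k j ->
  exists p : nat -> 'I_D, [/\ p k = j, forall l, (l <= k)%N -> (p l < pi (p l))%N
    & forall l l', (l < l')%N -> (l' <= k)%N -> (p l < p l')%N /\ (pi (p l') < pi (p l))%N].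
Proof.
elim: k j => [|k IH] j oj; first by exists (fun=> j); split=> // l l'; lia.
move=> /existsP[i /and3P[ij pij Hi]].
have oi : (i < pi i)%N by apply: ltn_trans ij _; apply: ltn_trans oj _.
have [p [pk po pn]] := IH i oi Hi.
exists (fun l => if (l <= k)%N then p l else j); split.
- by rewrite ltnn.
- by move=> l _; case: ifP => // /po.
- move=> l l' ll' l'k; have lk : (l <= k)%N by lia.
  rewrite lk; case: ifP => l'k'; first exact: pn.
  move: lk; rewrite leq_eqVlt => /orP[/eqP ->|lk]; first by rewrite pk.
  have [H1 H2] := pn l k lk (leqnn k); rewrite pk in H1 H2.
  by split; [exact: ltn_trans ij | exact: ltn_trans H2].
Qed.

End Nesting.

End Matchings.

Lemma matching_swap d : matching (swap d).
Proof. by apply/matchingP; split; [exact: swapK | exact: swap_neq]. Qed.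

Lemma prod_pairs_wt (S : comNzRingType) d (al : 'I_(d.*2) -> 'I_(d.*2) -> S)
    (s : {perm 'I_(d.*2)}) : (forall i j, al i j = - al j i) ->
  \prod_k al (s (evn_ord k)) (s (odd_ord k)) =
  (\prod_(k < d) (-1) ^+ (s (odd_ord k) < s (evn_ord k))%N) * wt al (swap d ^ s)%g.
Proof.
move=> al_skew; rewrite (wtJ _ al_skew (matching_swap d)).
rewrite [X in _ * X](eq_bigl (fun i : 'I_(d.*2) => ~~ odd i)); last exact: ltn_swap.
rewrite big_evn -big_split; apply: eq_bigr => k _ /=.
by rewrite swap_evn mulrA -signr_addb addbb mul1r.
Qed.

(** * The Pfaffian relation on nested arcs *)

Section NestingRelation.
Variables (D r : nat) (pi : {perm 'I_D}).
Hypothesis mpi : matching pi.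
Variable p : 'I_r -> 'I_D.
Hypothesis p_open : forall k, (p k < pi (p k))%N.
Hypothesis p_nest : forall k l : 'I_r, (k < l)%N ->
  (p k < p l)%N /\ (pi (p l) < pi (p k))%N.

Implicit Types (k l : 'I_r) (i j : 'I_D) (q : 'I_(r.*2)) (tau : 'S_(r.*2)).

Let piK : involutive pi. Proof. by case/matchingP: mpi. Qed.

(** Even indices give the openings and odd indices the closings, so that [swap] corresponds to
    [pi]. *)
Definition nest_pt (q : 'I_(r.*2)) : 'I_D :=
  if odd q then pi (p (half_ord q)) else p (half_ord q).
Local Notation u := nest_pt.

Lemma nest_evn k : u (evn_ord k) = p k.
Proof. by rewrite /u /= odd_double half_evn. Qed.

Lemma nest_odd k : u (odd_ord k) = pi (p k).
Proof. by rewrite /u /= odd_double half_odd. Qed.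

Lemma nest_swap q : u (swap r q) = pi (u q).
Proof.
by case: (ord_doubleP q) => k; rewrite (swap_evn, swap_odd) nest_evn nest_odd ?piK.
Qed.

Lemma nest_le k l : (k <= l)%N -> (p k <= p l)%N /\ (pi (p l) <= pi (p k))%N.
Proof.
rewrite leq_eqVlt => /orP[/eqP/val_inj -> //|/p_nest[]].
by split; exact: ltnW.
Qed.

(** The inner one of the two arcs separates both openings from both closings. *)
Lemma nest_lt k l : (p k < pi (p l))%N.
Proof.
have [kl|/ltnW lk] := leqP k l.
  by have [H _] := nest_le kl; apply: leq_ltn_trans H (p_open l).
by have [_ H] := nest_le lk; apply: leq_trans (p_open k) H.
Qed.

Lemma p_inj : injective p.
Proof.
move=> k l E; apply/val_inj/eqP; case: ltngtP => // /p_nest[];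
  by rewrite E ltnn.
Qed.

Lemma nest_inj : injective u.
Proof.
move=> q q'; case: (ord_doubleP q) => k; case: (ord_doubleP q') => l;
  rewrite ?nest_evn ?nest_odd.
- by move=> /p_inj ->.
- by move=> E; have := nest_lt k l; rewrite E ltnn.
- by move=> E; have := nest_lt l k; rewrite E ltnn.
- by move=> /perm_inj/p_inj ->.
Qed.

Definition ext_fun (tau : 'S_(r.*2)) i := if [pick q | u q == i] is Some q then u (tau q) else i.

Lemma ext_fun_nest tau q : ext_fun tau (u q) = u (tau q).
Proof.
rewrite /ext_fun; case: pickP => [q' /eqP/nest_inj -> //|/(_ q)].
by rewrite eqxx.
Qed.

Lemma ext_fun_out tau i : (forall q, u q != i) -> ext_fun tau i = i.
Proof. by move=> H; rewrite /ext_fun; case: pickP => // q; rewrite (negbTE (H q)). Qed.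

Variant in_nest_spec i : bool -> Type :=
  | InNest q of i = u q : in_nest_spec i true
  | OutNest of (forall q, u q != i) : in_nest_spec i false.

Lemma in_nestP i : in_nest_spec i [exists q, u q == i].
Proof.
case: (pickP (fun q => u q == i)) => [q /eqP <-|H].
- by have -> : [exists q0, u q0 == u q] by [apply/existsP; exists q]; exact: (@InNest _ q).
- have -> : [exists q, u q == i] = false by apply/negbTE/existsPn => q; rewrite H.
  by apply: OutNest => q; rewrite H.
Qed.

Lemma ext_fun_inj tau : injective (ext_fun tau).
Proof.
move=> i j; case: (in_nestP i) => [q ->|Hi]; case: (in_nestP j) => [q' ->|Hj];
  rewrite ?ext_fun_nest ?(ext_fun_out _ Hi) ?(ext_fun_out _ Hj).
- by move=> /nest_inj/perm_inj ->.
- by move=> E; have := Hj (tau q); rewrite E eqxx.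
- by move=> E; have := Hi (tau q'); rewrite E eqxx.
- by [].
Qed.

(** Conjugating [pi] by this permutation re-pairs the end points of the nested arcs and leaves the
    other arcs in place. *)
Definition ext tau : {perm 'I_D} := perm (@ext_fun_inj tau).

Lemma ext_nest tau q : ext tau (u q) = u (tau q).
Proof. by rewrite permE ext_fun_nest. Qed.

Lemma ext_out tau i : (forall q, u q != i) -> ext tau i = i.
Proof. by rewrite permE; exact: ext_fun_out. Qed.

Lemma nest_pi_out i : (forall q, u q != i) -> forall q, u q != pi i.
Proof.
by move=> H q; apply: contra (H (swap r q)) => /eqP E; rewrite nest_swap E piK.
Qed.

Lemma rewire_nest tau q : (pi ^ ext tau)%g (u (tau q)) = u (tau (swap r q)).
Proof. by rewrite -ext_nest permJ -nest_swap ext_nest. Qed.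

Lemma rewire_out tau i : (forall q, u q != i) -> (pi ^ ext tau)%g i = pi i.
Proof.
move=> H; rewrite -{1}(ext_out tau H) permJ ext_out //; exact: nest_pi_out.
Qed.

(** The first point [j] with a new partner is an opening, since a closing has its partner earlier,
    where nothing changed. The new partner is an opening, or the closing of a deeper arc because the
    outer arcs are still in place; in both cases it precedes [pi j]. *)
Lemma rewire_lex tau : (pi ^ ext tau)%g = pi \/ lex_lt (pi ^ ext tau)%g pi.
Proof.
set pi' := (pi ^ _)%g; have [->|/first_diff[j ne_j eq_j]] := eqVneq pi' pi; [by left|right].
have /matchingP[pi'K _] : matching pi' by exact: matchingJ.
have [q jE|jout] := in_nestP j; last by rewrite /pi' rewire_out ?eqxx in ne_j.
have pi'u a : exists b, pi' (u a) = u b.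
  by exists (tau (swap r ((tau^-1)%g a))); rewrite -{1}(permKV tau a) rewire_nest.
apply/lex_ltP; exists j => //.
case: (ord_doubleP q) jE => k; rewrite (nest_evn, nest_odd) => jE; last first.
  have := eq_j (p k); rewrite jE => /(_ (p_open k)) E.
  by move: ne_j; rewrite jE piK -E pi'K eqxx.
have [b] := pi'u (evn_ord k); rewrite nest_evn -jE.
case: (ord_doubleP b) => l; rewrite (nest_evn, nest_odd) => E.
  by rewrite E jE nest_lt.
rewrite E jE; have [lk|kl|/val_inj kl] := ltngtP l k.
- have [lt_p _] := p_nest lk.
  have /eq_j H : (p l < j)%N by rewrite jE.
  by move: E; rewrite -H => /perm_inj E; move: lt_p; rewrite -jE E ltnn.
- by have [] := p_nest kl.
- by move: ne_j; rewrite E jE kl eqxx.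
Qed.

(** The sign of the Pfaffian term [tau], corrected once for each pair that [tau] lists with its
    larger end point first. *)
Definition rewire_sign tau : bool :=
  odd_perm tau (+) \big[addb/false]_k (u (tau (odd_ord k)) < u (tau (evn_ord k)))%N.

Lemma signr_sum_addb (S : comPzRingType) (I : finType) (b : I -> bool) :
  (-1) ^+ (\big[addb/false]_i b i) = \prod_i (-1) ^+ b i :> S.
Proof. by apply: (big_morph (fun b : bool => (-1) ^+ b : S)) => // x y; rewrite signr_addb. Qed.

(** Here [tau] commutes with [swap], so its sign counts the blocks that it reverses, and these are
    exactly the pairs listed with the closing first: the two contributions cancel. *)
Lemma rewire_id_sign tau : (pi ^ ext tau)%g = pi -> rewire_sign tau = false.
Proof.
move=> E.
have tauC q : tau (swap r q) = swap r (tau q).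
  by apply: nest_inj; rewrite -rewire_nest E nest_swap.
suff : (-1) ^+ rewire_sign tau = 1 :> int by case: rewire_sign.
rewrite signr_addb (sign_block_perm _ tauC) signr_sum_addb -big_split big1 // => k _ /=.
rewrite -swap_evn tauC -signr_addb.
case: (ord_doubleP (tau (evn_ord k))) => l; rewrite (swap_evn, swap_odd) nest_evn nest_odd.
  by rewrite ltnNge ltnW ?p_open.
by rewrite p_open.
Qed.

(** The arcs of [pi] split into the nested ones, which [tau] re-pairs, and the remaining ones, which
    stay; the sign comes from orienting the new arcs. *)
Lemma wt_rewire (S : comNzRingType) (al : 'I_D -> 'I_D -> S) tau :
  (forall i j, al i j = - al j i) ->
  \prod_k al (u (tau (evn_ord k))) (u (tau (odd_ord k))) *
    \prod_(i < D | (i < pi i)%N && ~~ [exists q, u q == i]) al i (pi i) =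
  (-1) ^+ (\big[addb/false]_k (u (tau (odd_ord k)) < u (tau (evn_ord k)))%N) *
    wt al (pi ^ ext tau)%g.
Proof.
move=> al_skew; rewrite (wtJ _ al_skew mpi).
rewrite [in RHS](bigID (fun i => [exists q, u q == i])) /= mulrA; congr (_ * _); last first.
  apply: eq_bigr => i /andP[oi]; case: (in_nestP i) => // H _.
  rewrite !ext_out //; last exact: nest_pi_out.
  by rewrite ltnNge ltnW //= expr0 mul1r.
rewrite (eq_bigl (fun i => i \in p @: setT)); last first.
  move=> i; apply/idP/imsetP => [|[k _ ->]]; last first.
    by rewrite p_open; apply/existsP; exists (evn_ord k); rewrite nest_evn.
  case: (in_nestP i) => // q; last by rewrite andbF.
  case: (ord_doubleP q) => k; rewrite (nest_evn, nest_odd) => ->; first by exists k.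
  by rewrite piK ltnNge ltnW.
rewrite big_imset /=; last by move=> k l _ _; exact: p_inj.
under [X in _ = _ * X]eq_bigl do rewrite inE.
rewrite signr_sum_addb -big_split /=; apply: eq_bigr => k _.
rewrite -nest_evn -nest_swap swap_evn !ext_nest mulrA -signr_addb addbb mul1r.
by [].
Qed.

(** Several [tau] produce the same matching; their signs are collected here. *)
Definition rewire_coef pi' : int :=
  \sum_(tau | (pi ^ ext tau)%g == pi') (-1) ^+ rewire_sign tau.

(** No cancellation occurs: every contribution is 1 by [rewire_id_sign], and the identity
    contributes. *)
Lemma rewire_coef_id : rewire_coef pi != 0.
Proof.
rewrite /rewire_coef (eq_bigr (fun=> 1)); last by move=> tau /eqP/rewire_id_sign ->.
have ext1 : ext 1 = 1%g.
  apply/permP => i; rewrite perm1; case: (in_nestP i) => [q ->|/ext_out //].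
  by rewrite ext_nest perm1.
rewrite (bigD1 1%g) ?ext1 ?conjg1 //= gt_eqF // ltr_pwDl //.
by apply: sumr_ge0.
Qed.

Lemma rewire_coef_lex pi' : rewire_coef pi' != 0 -> pi' = pi \/ lex_lt pi' pi.
Proof.
move=> H; have [tau /eqP <-|none] := pickP (fun tau => (pi ^ ext tau)%g == pi').
  exact: rewire_lex.
by move: H; rewrite /rewire_coef big_pred0 // eqxx.
Qed.

Lemma rewire_coef_matching pi' : rewire_coef pi' != 0 -> matching pi'.
Proof.
move=> H; have [tau /eqP <-|none] := pickP (fun tau => (pi ^ ext tau)%g == pi').
  exact: matchingJ.
by move: H; rewrite /rewire_coef big_pred0 // eqxx.
Qed.

Lemma rewire_relation (S : comNzRingType) (al : 'I_D -> 'I_D -> S) :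
  (forall i j, al i j = - al j i) ->
  \sum_pi' (rewire_coef pi')%:~R * wt al pi' =
  (\prod_(i < D | (i < pi i)%N && ~~ [exists q, u q == i]) al i (pi i)) *
  pfsum (fun a b => al (u a) (u b)).
Proof.
move=> al_skew; rewrite /pfsum mulr_sumr [RHS](partition_big (fun tau => (pi ^ ext tau)%g) xpredT) //=.
apply: eq_bigr => pi' _; rewrite rmorph_sum mulr_suml.
apply: eq_bigr => tau /eqP <-.
rewrite [RHS]mulrCA [X in _ = _ * X]mulrC (wt_rewire _ al_skew) mulrA -signr_addb rmorph_sign.
by [].
Qed.

End NestingRelation.

(** * Multilinear relations *)

Section Independence.
Variables (R : realType) (n D : nat) (hn : (0 < n)%N).
Implicit Types (pi : {perm 'I_D}) (i j : 'I_D) (e : 'I_D -> 'I_(n + n)).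

Definition word_mx e i j : R := symp_mx R (e i) (e j).

(** Excludes n+1 nested arcs, since an opening with [n] enclosing arcs is the innermost of n+1. *)
Definition no_nesting pi := [forall i : 'I_D, (i < pi i)%N ==> ~~ nested_at pi n i].

(** The arc with label k receives the coordinate x^k at its opening and y^k at its closing, k
    counted from 0. The default of [insubd] is reached only for the label [n], which [no_nesting]
    excludes. *)
Definition std_word pi i : 'I_(n + n) :=
  let lab j := insubd (Ordinal hn) (nest_label pi n j) in
  if (i < pi i)%N then lshift n (lab i) else rshift n (lab (pi i)).

Lemma symp_neq0 p q : symp_mx R p q != 0 ->
  exists k : 'I_n, (p = lshift n k /\ q = rshift n k) \/ (p = rshift n k /\ q = lshift n k).
Proof.
case: (split_ordP p) => k ->; case: (split_ordP q) => l ->; rewrite sympE ?oppr_eq0 ?eqxx //;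
  have [->|_] := eqVneq k l; rewrite ?eqxx // => _; exists l; by [left|right].
Qed.

Lemma std_word_wt pi : matching pi -> wt (word_mx (std_word pi)) pi = 1.
Proof.
move=> mpi; apply: big1 => i oi; have [piK _] := matchingP _ mpi.
rewrite /word_mx /std_word oi piK ltnNge ltnW //= symp_lr.
by rewrite eqxx.
Qed.

(* among the matchings compatible with the word of [pi], [pi] joins at each step
   the first free opening to the first free closing with the same label *)
Lemma std_word_compat pi pi' : matching pi -> no_nesting pi -> matching pi' ->
  wt (word_mx (std_word pi)) pi' != 0 -> pi' = pi \/ lex_lt pi pi'.
Proof.
move=> mpi std mpi' wt0; have [piK pi_neq] := matchingP _ mpi.
have [pi'K pi'_neq] := matchingP _ mpi'.
have compat i : word_mx (std_word pi) i (pi' i) != 0.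
  have compat1 (k : 'I_D) : (k < pi' k)%N -> word_mx (std_word pi) k (pi' k) != 0.
    by move=> ok; apply: contraNneq wt0 => w0; rewrite /wt (bigD1 k) //= w0 mul0r.
  have [oi|] := boolP (i < pi' i)%N; first exact: compat1.
  rewrite -matching_ltn // => /compat1.
  by rewrite pi'K /word_mx symp_skew oppr_eq0.
have [->|ne] := eqVneq pi' pi; [by left|right].
have [j ne_j eq_j] := first_diff ne.
apply/lex_ltP; exists j; last by move=> i /eq_j.
(* Neither matching closes an arc at [j]: the partner would come earlier, where [pi] and [pi']
   agree. *)
have oj : (j < pi j)%N.
  have := pi_neq j; rewrite -val_eqE neq_ltn => /orP[/= /eq_j|//].
  by rewrite piK => E; rewrite -[in pi' j]E pi'K eqxx in ne_j.
have oj' : (j < pi' j)%N.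
  have := pi'_neq j; rewrite -val_eqE neq_ltn => /orP[/= /eq_j|//].
  by rewrite pi'K => E; rewrite [in pi j]E piK eqxx in ne_j.
have /symp_neq0[k] := compat j; rewrite /std_word oj.
case: ltnP => cj [[/lshift_inj kE E]|[E _]];
  try by move/eqP: E; rewrite eq_lrshift.
move: E => /rshift_inj; rewrite -kE => labE.
have lab_bound i : (i < pi i)%N -> (nest_label pi n i < n)%N.
  by move=> oi; apply: nest_label_bound => //; move: oi; apply/implyP; move/forallP: std.
(* [o] is the opening of the arc of [pi] that closes at [pi' j]; compatibility gives it the label of
   [j]. *)
pose o := pi (pi' j).
have oo : (o < pi o)%N.
  by rewrite /o piK ltn_neqAle cj andbT (inj_eq val_inj) pi_neq.
have {}labE : nest_label pi n o = nest_label pi n j.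
  by move/(congr1 val): labE; rewrite !val_insubd !lab_bound.
rewrite ltnNge leq_eqVlt (inj_eq val_inj) (negbTE ne_j) /=; apply/negP => lt_j.
(* Suppose [pi' j < pi j]. If [o] precedes [j], then [pi'] still joins it to [pi' j]. If it follows
   [j], its arc lies inside that of [j] and has a larger label. *)
have [oj_lt|jo|/val_inj o_eq] := ltngtP o j.
- have := eq_j o oj_lt; rewrite /o piK => /perm_inj E.
  by move: oj_lt; rewrite /o E ltnn.
- have nj : ~~ nested_at pi n j by move: oj; apply/implyP; move/forallP: std.
  have := @nest_label_lt _ pi n j o jo _ nj; rewrite /o piK => /(_ lt_j).
  by rewrite -/o labE ltnn.
- by move: ne_j; rewrite -o_eq /o piK -/o o_eq eqxx.
Qed.

End Independence.

Lemma a_sym_skew (R : realType) m (i j : 'I_m) : a_sym R i j = - a_sym R j i.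
Proof.
rewrite /a_sym; case: insubP => [p /= ij _|nij]; case: insubP => [q /= ji _|nji].
- by move: ij ji => /ltn_trans H /H; rewrite ltnn.
- by rewrite opprK.
- by [].
- by rewrite oppr0.
Qed.

(** * Multilinear relations lie in the Pfaffian ideal *)

Section Multilinear.
Variables (R : realType) (n m D : nat) (hn : (0 < n)%N) (h : 'I_D -> 'I_m).
Implicit Types (pi : {perm 'I_D}).

Definition sym_mx (i j : 'I_D) : symb_alg R m := a_sym R (h i) (h j).

Lemma sym_mx_skew i j : sym_mx i j = - sym_mx j i.
Proof. exact: a_sym_skew. Qed.

Lemma word_mx_skew (e : 'I_D -> 'I_(n + n)) i j : word_mx R e i j = - word_mx R e j i.
Proof. exact: symp_skew. Qed.

Lemma pfsum_word_mx (e : 'I_D -> 'I_(n + n)) (u : 'I_(n.+1.*2) -> 'I_D) :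
  pfsum (fun a b => word_mx R e (u a) (u b)) = 0.
Proof.
rewrite -[RHS](pfsum_gram (fun a => delta_mx (e (u a)) 0)).
by apply: eq_bigr => s _; congr (_ * _); apply: eq_bigr => k _; rewrite omega_delta.
Qed.

(** Induction on a bound for the rank of the matchings that occur. If the top one has no n+1 nested
    arcs, evaluation at its standard word isolates its coefficient: the others are smaller, while
    compatible ones are larger. Otherwise a multiple of the rewiring relation removes it and adds
    only smaller matchings. *)
Lemma matching_relations (y : {perm 'I_D} -> R) :
  (forall pi, y pi != 0 -> matching pi) ->
  (forall e : 'I_D -> 'I_(n + n), \sum_pi y pi * wt (word_mx R e) pi = 0) ->
  in_ideal_gen (@b_rel R m n) (\sum_pi y pi *: wt sym_mx pi).
Proof.
have [N] : exists N, forall pi, y pi != 0 -> (lex_rank pi < N)%N.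
  exists #|{perm 'I_D}|.+1 => pi _; rewrite ltnS.
  by rewrite -cardsT; apply: subset_leq_card; exact: subsetT.
elim: N y => [|N IH] y yN ym y0.
  rewrite big1 ?ideal_gen0 //; first exact: ideal_gen0.
  by move=> pi _; have [->|/yN//] := eqVneq (y pi) 0; rewrite scale0r.
have [pi /andP[/= ypi /eqP rk]|top0] :=
    pickP (fun pi => (y pi != 0) && (lex_rank pi == N)); last first.
  apply: IH => // pi ypi; have := yN pi ypi; rewrite ltnS leq_eqVlt => /orP[rk|//].
  by have := top0 pi; rewrite ypi rk.
have mpi := ym pi ypi.
have y_lex pi' : y pi' != 0 -> pi' = pi \/ lex_lt pi' pi.
  move=> ypi'; have := yN pi' ypi'; rewrite ltnS -rk => le_rk.
  have [->|/lex_lt_total/orP[|/lex_rank_lt]] := eqVneq pi' pi; [by left|by right|].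
  by rewrite ltnNge le_rk.
have [std|] := boolP (no_nesting n pi).
  have := y0 (std_word hn pi); rewrite (bigD1 pi) //= std_word_wt // mulr1 big1 ?addr0.
    by move=> E; rewrite E eqxx in ypi.
  move=> pi' ne; apply/eqP; rewrite mulf_eq0; apply/norP => -[ypi' wpi'].
  have [E|lt1] := std_word_compat mpi std (ym _ ypi') wpi'; first by rewrite E eqxx in ne.
  have [E|lt2] := y_lex _ ypi'; first by rewrite E eqxx in ne.
  by have := lex_lt_trans lt1 lt2; rewrite lex_lt_irr.
rewrite negb_forall => /existsP[i]; rewrite negb_imply negbK => /andP[oi].
move=> /(nested_chain oi)[p' [_ po pn]].
pose p (k : 'I_n.+1) := p' k.
have p_open k : (p k < pi (p k))%N by apply: po; rewrite -ltnS.
have p_nest (k l : 'I_n.+1) : (k < l)%N -> (p k < p l)%N /\ (pi (p l) < pi (p k))%N.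
  by move=> kl; apply: pn => //; rewrite -ltnS.
pose c pi' : R := (rewire_coef p_open p_nest pi')%:~R.
have cpi : c pi != 0 by rewrite intr_eq0 rewire_coef_id.
have c0 pi' : c pi' != 0 -> pi' = pi \/ lex_lt pi' pi.
  by rewrite intr_eq0; exact: rewire_coef_lex.
have cm pi' : c pi' != 0 -> matching pi' by rewrite intr_eq0; exact: rewire_coef_matching.
pose a := y pi / c pi.
have -> : \sum_pi' y pi' *: wt sym_mx pi' =
   \sum_pi' (y pi' - a * c pi') *: wt sym_mx pi' + a *: \sum_pi' c pi' *: wt sym_mx pi'.
  rewrite scaler_sumr -big_split; apply: eq_bigr => pi' _ /=.
  by rewrite scalerA -scalerDl subrK.
have y'0 pi' : y pi' - a * c pi' != 0 -> y pi' != 0 \/ c pi' != 0.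
  have [->|] := eqVneq (y pi') 0; [move=> H; right|by left].
  by apply: contraNneq H => ->; rewrite mulr0 subr0.
apply: ideal_genD.
- apply: IH => [pi' ne0|pi' ne0|e].
  + have : pi' = pi \/ lex_lt pi' pi by have [/y_lex|/c0] := y'0 _ ne0.
    case=> [E|/lex_rank_lt]; last by rewrite rk.
    by move: ne0; rewrite E /a divfK // subrr eqxx.
  + by have [/ym|/cm] := y'0 _ ne0.
  + under eq_bigr do rewrite mulrBl -mulrA.
    rewrite sumrB y0 -mulr_sumr /c (rewire_relation mpi p_open p_nest (@word_mx_skew e)).
    by rewrite pfsum_word_mx !mulr0 subr0.
- rewrite -mul_mpolyC; apply: ideal_genM.
  under eq_bigr do rewrite /c -mul_mpolyC rmorph_int.
  rewrite (rewire_relation mpi p_open p_nest sym_mx_skew).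
  by apply: ideal_genM; exact: pfsum_ideal.
Qed.

End Multilinear.

(** Passes from permutations to matchings: the [s] with the same [swap d ^ s] give the same product
    up to the orientation sign [eps s]. *)
Lemma multilinear_relations (R : realType) (n m d : nat) (hn : (0 < n)%N)
    (h : 'I_(d.*2) -> 'I_m) (x : {perm 'I_(d.*2)} -> R) :
  (forall e : 'I_(d.*2) -> 'I_(n + n),
     \sum_s x s * \prod_k symp_mx R (e (s (evn_ord k))) (e (s (odd_ord k))) = 0) ->
  in_ideal_gen (@b_rel R m n)
    (\sum_s x s *: \prod_k a_sym R (h (s (evn_ord k))) (h (s (odd_ord k)))).
Proof.
move=> x0; pose eps (s : {perm 'I_(d.*2)}) : int :=
  \prod_(k < d) (-1) ^+ (s (odd_ord k) < s (evn_ord k))%N.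
pose y pi := \sum_(s | (swap d ^ s)%g == pi) x s * (eps s)%:~R.
have -> : \sum_s x s *: \prod_k a_sym R (h (s (evn_ord k))) (h (s (odd_ord k))) =
    \sum_pi y pi *: wt (sym_mx R h) pi.
  rewrite (partition_big (fun s => (swap d ^ s)%g) xpredT) //=; apply: eq_bigr => pi _.
  rewrite scaler_suml; apply: eq_bigr => s /eqP <-.
  rewrite -scalerA; congr (_ *: _).
  rewrite (prod_pairs_wt s (@sym_mx_skew R m _ h)) -mul_mpolyC rmorph_int; congr (_ * _).
  by rewrite rmorph_prod; apply: eq_bigr => k _; rewrite rmorph_sign.
apply: (@matching_relations R n m _ hn) => [pi|e].
  move=> ypi; have [s /eqP <-|none] := pickP (fun s => (swap d ^ s)%g == pi).
    exact/matchingJ/matching_swap.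
  by rewrite /y big_pred0 ?eqxx in ypi.
rewrite -[RHS](x0 e) [RHS](partition_big (fun s => (swap d ^ s)%g) xpredT) //=.
apply: eq_bigr => pi _; rewrite mulr_suml; apply: eq_bigr => s /eqP <-.
rewrite -mulrA; congr (_ * _).
rewrite (prod_pairs_wt s (@word_mx_skew R n _ e)); congr (_ * _).
by rewrite rmorph_prod; apply: eq_bigr => k _; rewrite rmorph_sign.
Qed.

(** * Polarization and the ideal of relations *)

Lemma prod_bool (S : comPzSemiRingType) (I : finType) (b : pred I) :
  \prod_i (b i)%:R = [forall i, b i]%:R :> S.
Proof.
have [/forallP bT|] := boolP [forall i, b i]; first by rewrite big1 // => i _; rewrite bT.
by rewrite negb_forall => /existsP[i /negbTE bi]; rewrite (bigD1 i) //= bi mul0r.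
Qed.

Section Polarization.
Variables (R : realType) (n m d : nat).
Local Notation D := (d.*2).
Implicit Types (g : {ffun 'I_D -> 'I_D}) (v : 'I_D -> 'cV[R]_(n + n)).

Definition inj_filter (chi : {ffun 'I_D -> bool}) : R := \prod_j (if chi j then 1 else -1).

(* inclusion-exclusion over the subsets [chi] of the points *)
Lemma inj_filterE g :
  \sum_(chi : {ffun 'I_D -> bool}) inj_filter chi * \prod_i (chi (g i))%:R = (injectiveb g)%:R.
Proof.
have surjE : injectiveb g = [forall j, j \in codom g].
  apply/injectiveP/forallP => [g_inj j|g_surj]; first exact: (injF_onto g_inj).
  apply/injectiveP; rewrite /injectiveb /dinjectiveb; apply/card_uniqP.
  rewrite size_map -cardE; apply/eqP; rewrite eqn_leq leq_image_card /=.
  by apply: subset_leq_card; apply/subsetP => j _; have := g_surj j.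
transitivity (\sum_(chi : {ffun 'I_D -> bool})
    \prod_j ((if chi j then 1 else -1) * ((j \in codom g) ==> chi j)%:R : R)).
  apply: eq_bigr => chi _; rewrite big_split /= !prod_bool; congr (_ * _%:R).
  congr (nat_of_bool _); apply/forallP/forallP => H i.
    by apply/implyP => /codomP[j ->].
  by have /implyP := H (g i); apply; exact: codom_f.
(* The sum over [chi] factors; the point [j] contributes 1 minus the indicator of [j] lying outside
   the image of [g]. *)
rewrite -(bigA_distr_bigA (fun j (b : bool) => (if b then 1 else -1) * ((j \in codom g) ==> b)%:R : R)).
rewrite surjE -prod_bool; apply: eq_bigr => j _; rewrite big_bool /= implybT implybF.
by case: (j \in _); rewrite /= ?mulr0 ?mulr1 ?addr0 ?subrr.
Qed.

Variable c : {ffun 'I_D -> 'I_m} -> R.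
Hypothesis c0 : forall A : config R n m,
  \sum_h c h * \prod_k omega (A (h (evn_ord k))) (A (h (odd_ord k))) = 0.

Let W v (g : 'I_D -> 'I_D) : R := \prod_k omega (v (g (evn_ord k))) (v (g (odd_ord k))).

(** This is [c0] at the configuration whose vector [A i] is the sum of the [v j] over the points [j]
    of [chi] with label [i]; multilinear expansion gives one term for each [g]. *)
Lemma polarize_subset v (h0 : {ffun 'I_D -> 'I_m}) (chi : {ffun 'I_D -> bool}) :
  \sum_(g : {ffun 'I_D -> 'I_D}) c [ffun i => h0 (g i)] * W v g * \prod_i (chi (g i))%:R = 0.
Proof.
pose A : config R n m := fun i => \sum_(j | chi j && (h0 j == i)) v j.
rewrite -[RHS](c0 A).
transitivity (\sum_(h : {ffun 'I_D -> 'I_m}) \sum_(g : {ffun 'I_D -> 'I_D}) c h * (W v g *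
    \prod_i (chi (g i) && (h0 (g i) == h i))%:R)).
  rewrite exchange_big; apply: eq_bigr => g _ /=.
  rewrite (bigD1 [ffun i => h0 (g i)]) //= [X in _ + X]big1 ?addr0.
    rewrite -mulrA; congr (_ * (_ * _)); apply: eq_bigr => i _.
    by rewrite ffunE eqxx andbT.
  move=> h ne_h; rewrite prod_bool.
  have /negbTE -> : ~~ [forall i, chi (g i) && (h0 (g i) == h i)]; last by rewrite !mulr0.
  apply: contra ne_h => /forallP H; apply/eqP/ffunP => i; rewrite ffunE.
  by have /andP[_ /eqP] := H i.
apply: eq_bigr => h _; rewrite -mulr_sumr; congr (_ * _).
transitivity (\prod_(k < d) \sum_(i : 'I_D) \sum_(j : 'I_D)
   (omega (v i) (v j) * ((chi i && (h0 i == h (evn_ord k)))%:R *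
      (chi j && (h0 j == h (odd_ord k)))%:R))).
  rewrite (prod_sum_pairs (fun k i j => omega (v i) (v j) * ((chi i && (h0 i == h (evn_ord k)))%:R *
      (chi j && (h0 j == h (odd_ord k)))%:R))).
  by apply: eq_bigr => g _; rewrite big_split big_pairs.
apply: eq_bigr => k _; rewrite /A omega_suml [RHS]big_mkcond; apply: eq_bigr => i _ /=.
case: ifP => _; last by rewrite big1 // => j _; rewrite mul0r mulr0.
rewrite omega_sumr [RHS]big_mkcond; apply: eq_bigr => j _ /=.
by case: ifP => _; rewrite ?mulr1 ?mulr0.
Qed.

(** Combining the subsets [chi] by inclusion-exclusion leaves only the injective [g], which are the
    permutations. *)
Lemma polarization v (h0 : {ffun 'I_D -> 'I_m}) :
  \sum_(s : 'S_D) c [ffun i => h0 (s i)] *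
    \prod_k omega (v (s (evn_ord k))) (v (s (odd_ord k))) = 0.
Proof.
transitivity (\sum_(g : {ffun 'I_D -> 'I_D}) c [ffun i => h0 (g i)] * W v g * (injectiveb g)%:R).
  rewrite [RHS](bigID (fun g : {ffun 'I_D -> 'I_D} => injectiveb g)) /= [X in _ + X]big1 ?addr0.
    rewrite [RHS](reindex (@pval _)) /=; last first.
      pose in_Sn := insubd (1%g : 'S_D).
      by exists in_Sn => /= f Uf; first apply: val_inj; apply: insubdK.
    apply: eq_big => /= [s | s _]; rewrite ?(valP s) // mulr1; congr (_ * _).
    - by congr c; apply/ffunP => i; rewrite !ffunE pvalE.
    - by apply: eq_bigr => k _; rewrite !pvalE.
  by move=> g /negbTE ->; rewrite mulr0.
under eq_bigr do rewrite -inj_filterE mulr_sumr.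
rewrite exchange_big big1 //= => chi _.
transitivity (inj_filter chi * \sum_(g : {ffun 'I_D -> 'I_D})
    c [ffun i => h0 (g i)] * W v g * \prod_i (chi (g i))%:R).
  by rewrite mulr_sumr; apply: eq_bigr => g _; rewrite mulrCA.
by rewrite polarize_subset mulr0.
Qed.

End Polarization.

(** * The kernel: relations of arbitrary degree *)

Section Relations.
Variables (R : realType) (n m : nat) (hn : (0 < n)%N).

Definition symb_val (A : config R n m) (t : 'I_#|{: symbol m}|) : R :=
  omega (A (val (enum_val t)).1) (A (val (enum_val t)).2).

Lemma a_sym_val A i j : (a_sym R i j).@[symb_val A] = omega (A i) (A j).
Proof.
rewrite /a_sym; case: insubP => [p /= _ /= pE|nij].
  by rewrite mevalXU /symb_val enum_rankK /= pE.
case: insubP => [p /= _ /= pE|nji].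
  by rewrite mevalN mevalXU /symb_val enum_rankK /= pE -omega_skew.
have -> : i = j by apply/val_inj/eqP; rewrite eqn_leq; move: nij nji; rewrite /= -!leqNgt => -> ->.
by rewrite meval0 omegavv.
Qed.

Lemma symb_val_scale (s : R) A t : symb_val (fun i => s *: A i) t = s ^+ 2 * symb_val A t.
Proof. by rewrite /symb_val omegaZ expr2. Qed.

Lemma homog_meval_scale N d (s : R) (v : 'I_N -> R) (p : {mpoly R[N]}) :
  p \is d.-homog for mdeg -> p.@[fun i => s * v i] = s ^+ d * p.@[v].
Proof.
move=> /dhomogP p_hom; rewrite !mevalE mulr_sumr; apply: eq_big_seq => u /p_hom /= <-.
rewrite mulrCA; congr (_ * _).
under eq_bigr do rewrite exprMn.
by rewrite big_split /= -expr_sum mdegE.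
Qed.

(** Scaling all vectors by the square root of i multiplies every a_ij by i, so the values of the
    homogeneous components are the coefficients of a polynomial in i. It has size at most [K] and
    vanishes at 0, ..., K-1. *)
Lemma pihomog_val0 (q : symb_alg R m) d : (forall A, q.@[symb_val A] = 0) ->
  forall A, (pihomog mdeg d q).@[symb_val A] = 0.
Proof.
move=> q0 A; pose K := msize q; pose P := \poly_(e < K) (pihomog mdeg e q).@[symb_val A].
have P0 : P = 0.
  apply: (@roots_geq_poly_eq0 _ P [seq i%:R | i <- iota 0 K]).
  - apply/allP => x /mapP[i _ ->]; apply/rootP; rewrite horner_poly.
    rewrite -[RHS](q0 (fun j => Num.sqrt i%:R *: A j)).
    rewrite [in RHS](pihomog_partitionE (leqnn (msize q))) raddf_sum /=.
    apply: eq_bigr => e _.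
    rewrite (meval_eq _ (symb_val_scale _ A)) sqr_sqrtr ?ler0n //.
    by rewrite (homog_meval_scale _ _ (pihomogP _ _ _)) mulrC.
  - by rewrite map_inj_uniq ?iota_uniq //; apply: mulrIn; rewrite oner_neq0.
  - by rewrite size_map size_iota size_poly.
have [dK|Kd] := ltnP d K.
  by have /(congr1 (fun p : {poly R} => p`_d)) := P0; rewrite coef_poly dK coef0.
rewrite pihomogE big_seq_cond big1 ?meval0 // => u /andP[/msize_mdeg_lt lt_u /eqP E].
by move: lt_u; rewrite /= E ltnNge Kd.
Qed.

Definition sym_word d (h : 'I_(d.*2) -> 'I_m) : symb_alg R m :=
  \prod_k a_sym R (h (evn_ord k)) (h (odd_ord k)).

Lemma mpolyX_seq N (u : 'X_{1..N}) :
  'X_[R, u] = \prod_(i <- m2s u) 'X_i.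
Proof.
rewrite mpolyXE_id /m2s big_flatten big_map /= big_enum; apply: eq_bigr => i _.
by rewrite big_nseq -Monoid.iteropE.
Qed.

Lemma a_sym_symbol (p : symbol m) : a_sym R (val p).1 (val p).2 = 'X_(enum_rank p).
Proof.
rewrite /a_sym; case: insubP => [p' _ /= E|]; last by rewrite (valP p).
by congr 'X_(enum_rank _); apply: val_inj; rewrite /= E -surjective_pairing.
Qed.

Lemma sym_word_mpolyX d (u : 'X_{1..#|{: symbol m}|}) : mdeg u = d ->
  exists h : {ffun 'I_(d.*2) -> 'I_m}, 'X_[R, u] = sym_word h.
Proof.
rewrite -size_m2s => <-; rewrite mpolyX_seq.
set s := m2s u; pose t := in_tuple s.
exists [ffun i => let p := val (enum_val (tnth t (half_ord i))) in
  if odd i then p.2 else p.1].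
rewrite big_tnth; apply: eq_bigr => k _.
by rewrite !ffunE /= odd_double /= half_evn half_odd a_sym_symbol enum_valK.
Qed.

Lemma homog_sym_word d (q : symb_alg R m) : q \is d.-homog for mdeg ->
  exists c : {ffun 'I_(d.*2) -> 'I_m} -> R, q = \sum_h c h *: sym_word h.
Proof.
move=> /dhomogP q_hom; rewrite [q]mpolyE big_seq.
elim/big_ind: _ => [|p1 p2 [c1 ->] [c2 ->]|].
- by exists (fun=> 0); rewrite big1 // => h _; rewrite scale0r.
- exists (fun h => c1 h + c2 h); rewrite -big_split; apply: eq_bigr => h _.
  by rewrite scalerDl.
- move=> u /q_hom/= /sym_word_mpolyX[h ->].
  exists (fun h' => q@_u *+ (h' == h)).
  rewrite -(sum_delta h (fun h' : {ffun 'I_(d.*2) -> 'I_m} => q@_u *: sym_word h')).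
  by apply: eq_bigr => h' _; rewrite scalerMnl.
Qed.

(** Averaging [q] over all permutations of the 2d positions of a word does not change it. For a
    fixed labelling [h0] the average is a multilinear expression, and polarization at basis vectors
    provides its vanishing on words. *)
Lemma homog_relations d (q : symb_alg R m) : q \is d.-homog for mdeg ->
  (forall A, q.@[symb_val A] = 0) -> in_ideal_gen (@b_rel R m n) q.
Proof.
move=> /homog_sym_word[c qE] q0.
have c0 (A : config R n m) :
    \sum_h c h * \prod_k omega (A (h (evn_ord k))) (A (h (odd_ord k))) = 0.
  rewrite -[RHS](q0 A) qE raddf_sum; apply: eq_bigr => h _ /=.
  rewrite mevalZ rmorph_prod; congr (_ * _); apply: eq_bigr => k _.
  by rewrite /= a_sym_val.
have -> : q = (((d.*2)`!%:R)^-1 : R) *: \sum_(h0 : {ffun 'I_(d.*2) -> 'I_m})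
    \sum_(s : 'S_(d.*2)) c [ffun i => h0 (s i)] *: sym_word (fun i => h0 (s i)).
  have -> : \sum_(h0 : {ffun 'I_(d.*2) -> 'I_m})
    \sum_(s : 'S_(d.*2)) c [ffun i => h0 (s i)] *: sym_word (fun i => h0 (s i)) =
    \sum_(s : 'S_(d.*2)) q.
    rewrite exchange_big; apply: eq_bigr => s _ /=.
    rewrite qE [RHS](reindex (fun h0 : {ffun 'I_(d.*2) -> 'I_m} => [ffun i => h0 (s i)])) /=.
      apply: eq_bigr => h0 _; congr (_ *: _).
      by apply: eq_bigr => k _; rewrite !ffunE.
    exists (fun h0 : {ffun 'I_(d.*2) -> 'I_m} => [ffun i => h0 ((s^-1)%g i)]) => h0 _;
      by apply/ffunP => i; rewrite !ffunE ?permK ?permKV.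
  rewrite sumr_const card_Sn -scaler_nat scalerA mulVf ?scale1r //.
  by rewrite pnatr_eq0 -lt0n fact_gt0.
rewrite -mul_mpolyC; apply: ideal_genM; apply: ideal_gen_sum => h0 _.
apply: (@multilinear_relations R n m d hn h0 (fun s => c [ffun i => h0 (s i)])) => e.
rewrite -[RHS](polarization c0 (fun i => delta_mx (e i) 0) h0).
by apply: eq_bigr => s _; congr (_ * _); apply: eq_bigr => k _; rewrite omega_delta.
Qed.

Lemma relations_complete (q : symb_alg R m) :
  (forall A, q.@[symb_val A] = 0) -> in_ideal_gen (@b_rel R m n) q.
Proof.
move=> q0; rewrite (pihomog_partitionE (mf := mdeg) (leqnn (msize q))).
apply: ideal_gen_sum => d _; apply: (@homog_relations d); first exact: pihomogP.
exact: pihomog_val0.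
Qed.

Lemma relations_sound (q : symb_alg R m) :
  in_ideal_gen (@b_rel R m n) q -> forall A, q.@[symb_val A] = 0.
Proof.
move=> [k [c [b [Bb ->]]]] A; rewrite raddf_sum big1 //= => l _.
have [s [_ ->]] := Bb l; rewrite mevalM /b_pfaff pfaffianE mevalZ rmorph_pfsum.
rewrite (_ : pfsum _ = 0) ?mulr0 // -[RHS](pfsum_gram (fun p => A (s p))).
by apply: eq_bigr => t _; congr (_ * _); apply: eq_bigr => i _; rewrite mxE /= a_sym_val.
Qed.

End Relations.

(** * Multivariate polynomials *)

Section Degree.
Variables (R : idomainType) (N : nat).
Implicit Types (p q : {mpoly R[N]}).

Lemma msizeM_bound p q a b :
  (msize p <= a.+1)%N -> (msize q <= b.+1)%N -> (msize (p * q) <= (a + b).+1)%N.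
Proof.
have [->|p0] := eqVneq p 0; first by rewrite mul0r msize0.
have [->|q0] := eqVneq q 0; first by rewrite mulr0 msize0.
by rewrite msizeM //; lia.
Qed.

Lemma msizeD_bound p q a :
  (msize p <= a)%N -> (msize q <= a)%N -> (msize (p + q) <= a)%N.
Proof. by move=> pa qa; apply: leq_trans (msizeD_le _ _) _; rewrite geq_max pa qa. Qed.

Lemma msizeZ_bound (c : R) p a : (msize p <= a)%N -> (msize (c *: p) <= a)%N.
Proof. by move=> pa; apply: leq_trans (msizeZ_le _ _) pa. Qed.

Lemma msize_sum_bound (I : Type) (r : seq I) (P : pred I) (F : I -> {mpoly R[N]}) a :
  (forall i, P i -> (msize (F i) <= a)%N) -> (msize (\sum_(i <- r | P i) F i) <= a)%N.
Proof.
move=> Fa; apply: (big_ind (fun p => (msize p <= a)%N)) => //; first by rewrite msize0.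
by move=> p q; exact: msizeD_bound.
Qed.

Lemma msize_prod_bound (I : Type) (r : seq I) (F : I -> {mpoly R[N]}) (a : I -> nat) :
  (forall i, (msize (F i) <= (a i).+1)%N) ->
  (msize (\prod_(i <- r) F i) <= (\sum_(i <- r) a i).+1)%N.
Proof.
move=> Fa; elim: r => [|i r IH]; first by rewrite !big_nil msize1.
by rewrite !big_cons; exact: msizeM_bound.
Qed.

Lemma msizeX_bound p a k :
  (msize p <= a.+1)%N -> (msize (p ^+ k) <= (k * a).+1)%N.
Proof.
move=> pa; elim: k => [|k IH]; first by rewrite expr0 msize1.
by rewrite exprS mulSn; exact: msizeM_bound.
Qed.

Lemma msize_coef p a : (forall u, (a <= mdeg u)%N -> p@_u = 0) -> (msize p <= a)%N.
Proof.
move=> pa; rewrite msizeE; apply/bigmax_leqP_seq => u; rewrite mcoeff_msupp => pu _.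
by rewrite ltnNge; apply: contra pu => /pa ->.
Qed.

Lemma coef_msize p a u : (msize p <= a)%N -> (a <= mdeg u)%N -> p@_u = 0.
Proof.
by move=> pa au; apply: memN_msupp_eq0; apply: msize_mdeg_ge; exact: leq_trans pa au.
Qed.

Lemma msize_mderiv p i a : (msize p <= a)%N -> (msize p^`M(i) <= a.-1)%N.
Proof.
move=> pa; apply: msize_coef => u au; rewrite mcoeff_mderiv (coef_msize pa) ?mul0rn //.
by rewrite mdegD mdeg1; lia.
Qed.

End Degree.

Section MpolyInd.
Variables (R : comNzRingType) (N : nat) (P : {mpoly R[N]} -> Prop).

Lemma mpoly_ring_ind : (forall c, P c%:MP) -> (forall i, P 'X_i) ->
  (forall p q, P p -> P q -> P (p + q)) -> (forall p q, P p -> P q -> P (p * q)) ->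
  forall p, P p.
Proof.
move=> PC PX PD PM p; rewrite [p]mpolyE.
apply: big_ind => [|q1 q2|u _]; [by rewrite -mpolyC0|exact: PD|].
rewrite -mul_mpolyC; apply: (PM) => //; rewrite mpolyXE_id.
apply: big_ind => [|q1 q2|i _]; [by rewrite -mpolyC1|exact: PM|].
by elim: (u i) => [|k IH]; rewrite ?expr0 -?mpolyC1 // exprS; exact: PM.
Qed.

End MpolyInd.

(** * Restriction to lines and vanishing polynomial functions *)

Section Line.
Variables (R : realType) (N : nat).
Implicit Types (v c : 'I_N -> R) (f : {mpoly R[N]}).

Definition line v c f : {poly R} := mmap polyC (fun i => (v i)%:P + (c i)%:P * 'X) f.

Lemma line_horner v c f t : (line v c f).[t] = f.@[fun i => v i + c i * t].
Proof.
rewrite /line /mmap horner_sum mevalE; apply: eq_bigr => u _.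
rewrite hornerM hornerC horner_prod; congr (_ * _); apply: eq_bigr => i _.
by rewrite horner_exp !hornerE.
Qed.

Lemma line_deriv v c f : (line v c f)^`() = \sum_i (c i)%:P * line v c f^`M(i).
Proof.
elim/mpoly_ring_ind: f => [a|j|p q pE qE|p q pE qE].
- rewrite /line mmapC derivC big1 // => i _.
  by rewrite mderivC mmap0 mulr0.
- rewrite /line mmapX mmap1U derivD derivC derivM derivC derivX mul0r !add0r mulr1.
  rewrite (bigD1 j) //= big1 ?addr0.
    by rewrite mderivX mnm1E eqxx -{1}[U_(j)%MM]add0m addmK mpolyX0 scale1r -mpolyC1 mmapC mulr1.
  by move=> i ij; rewrite mderivX mnm1E eq_sym (negbTE ij) scale0r mmap0 mulr0.
- rewrite /line mmapD derivD -!/(line _ _ _) pE qE -big_split; apply: eq_bigr => i _ /=.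
  by rewrite mderivD /line mmapD mulrDr.
- rewrite /line rmorphM /= derivM -!/(line _ _ _) pE qE mulr_suml mulr_sumr -big_split.
  apply: eq_bigr => i _ /=; rewrite mderivM /line mmapD !rmorphM /=; ring.
Qed.

Lemma poly_fun_eq0 (p : {poly R}) : (forall t, p.[t] = 0) -> p = 0.
Proof.
move=> p0; apply: (@roots_geq_poly_eq0 _ p [seq i%:R | i <- iota 0 (size p)]).
- by apply/allP => x _; apply/rootP.
- by rewrite map_inj_uniq ?iota_uniq //; apply: mulrIn; rewrite oner_neq0.
- by rewrite size_map size_iota.
Qed.

(** The restriction to the line is a constant polynomial, and the sum is its derivative at 0. *)
Lemma line_const_deriv v c f : (forall t, f.@[fun i => v i + c i * t] = f.@[v]) ->
  \sum_i c i * f^`M(i).@[v] = 0.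
Proof.
move=> fv; have lE : line v c f = (f.@[v])%:P.
  apply/eqP; rewrite -subr_eq0; apply/eqP/poly_fun_eq0 => t.
  by rewrite hornerD hornerN hornerC line_horner fv subrr.
have := congr1 (fun p : {poly R} => p^`().[0]) lE.
rewrite line_deriv derivC horner0 horner_sum => E; rewrite -[RHS]E; apply: eq_bigr => i _.
rewrite hornerM hornerC line_horner; congr (_ * _).
by apply: meval_eq => j; rewrite mulr0 addr0.
Qed.

Lemma meval_at0 f : f.@[fun=> 0] = f@_0%MM.
Proof.
elim/mpoly_ring_ind: f => [a|j|p q pE qE|p q pE qE].
- by rewrite mevalC mcoeffC eqxx mulr1.
- by rewrite mevalXU mcoeffX mnm1_eq0.
- by rewrite mevalD mcoeffD pE qE.
- by rewrite mevalM (rmorphM (mcoeff 0%MM)) /= pE qE.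
Qed.

Lemma mnm_neq0_ex (u : 'X_{1..N}) : u != 0%MM -> exists i, u i != 0%N.
Proof.
move=> u0; apply/existsP; apply: contraR u0 => /existsPn H.
by apply/eqP/mnmP => i; rewrite mnm0E; apply/eqP; have := H i; rewrite negbK.
Qed.

(** Induction on the degree of the monomial: the constant coefficient is the value at 0, and the
    others are, up to nonzero integers, coefficients of partial derivatives, which vanish as
    functions too. *)
Lemma mpoly_fun_eq0 f : (forall v, f.@[v] = 0) -> f = 0.
Proof.
move=> f0; apply/mpolyP => u; rewrite mcoeff0.
have [k] := ubnP (mdeg u); elim: k u f f0 => // k IH u f f0 le_u.
have [->|/mnm_neq0_ex[i ui]] := eqVneq u 0%MM; first by rewrite -meval_at0.
have uE : u = (u - U_(i) + U_(i))%MM by rewrite submK // lep1mP.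
have := IH (u - U_(i))%MM f^`M(i); rewrite mcoeff_mderiv -uE => /(_ _ _)/eqP.
rewrite mulrn_eq0 /= => H; apply/eqP; apply: H => [v|].
  have := line_const_deriv (v := v) (c := fun j => (j == i)%:R) (f := f).
  under eq_bigr do rewrite mulr_natl.
  by rewrite sum_delta; apply => t; rewrite !f0.
by move: le_u; rewrite {1}uE mdegD mdeg1; lia.
Qed.

End Line.

(** * The Fischer inner product *)

Section Fischer.
Variables (R : realType) (N K : nat).
Implicit Types (p q : {mpoly R[N]}) (u w : 'X_{1..N}).

Definition mfact u := (\prod_i (u i)`!)%N.

(* only the coefficients of degree < [K] are taken into account *)
Definition fischer p q : R :=
  \sum_(u : 'X_{1..N < K}) (mfact u)%:R * p@_u * q@_u.

Lemma fischerC p q : fischer p q = fischer q p.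
Proof. by apply: eq_bigr => u _; rewrite mulrAC. Qed.

Lemma fischerDl p1 p2 q : fischer (p1 + p2) q = fischer p1 q + fischer p2 q.
Proof. by rewrite -big_split; apply: eq_bigr => u _ /=; rewrite mcoeffD; ring. Qed.

Lemma fischerZl c p q : fischer (c *: p) q = c * fischer p q.
Proof. by rewrite mulr_sumr; apply: eq_bigr => u _; rewrite mcoeffZ; ring. Qed.

Lemma fischerDr p q1 q2 : fischer p (q1 + q2) = fischer p q1 + fischer p q2.
Proof. by rewrite !(fischerC p) fischerDl. Qed.

Lemma fischerZr c p q : fischer p (c *: q) = c * fischer p q.
Proof. by rewrite !(fischerC p) fischerZl. Qed.

Lemma fischer0l q : fischer 0 q = 0.
Proof. by rewrite -(scale0r 0) fischerZl mul0r. Qed.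

Lemma fischer0r p : fischer p 0 = 0.
Proof. by rewrite fischerC fischer0l. Qed.

Lemma fischer_suml (I : Type) (r : seq I) (P : pred I) (F : I -> {mpoly R[N]}) q :
  fischer (\sum_(i <- r | P i) F i) q = \sum_(i <- r | P i) fischer (F i) q.
Proof. by apply: (big_morph (fischer^~ q)); [move=> *; exact: fischerDl|exact: fischer0l]. Qed.

Lemma fischer_sumr (I : Type) (r : seq I) (P : pred I) (F : I -> {mpoly R[N]}) q :
  fischer q (\sum_(i <- r | P i) F i) = \sum_(i <- r | P i) fischer q (F i).
Proof. by rewrite fischerC fischer_suml; apply: eq_bigr => i _; rewrite fischerC. Qed.

Lemma fischer_ge0 p : 0 <= fischer p p.
Proof. by apply: sumr_ge0 => u _; rewrite -mulrA mulr_ge0 ?ler0n // -expr2 sqr_ge0. Qed.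

Lemma mfact_gt0 u : (0 < mfact u)%N.
Proof. by apply: prodn_gt0 => i; rewrite fact_gt0. Qed.

Lemma fischer_eq0 p : fischer p p = 0 -> forall u, (mdeg u < K)%N -> p@_u = 0.
Proof.
move=> /eqP; rewrite psumr_eq0 => [/allP p0 u uK|u _]; last first.
  by rewrite -mulrA mulr_ge0 ?ler0n // -expr2 sqr_ge0.
have /eqP := p0 (BMultinom uK) (mem_index_enum _).
move/eqP; rewrite -mulrA !mulf_eq0 pnatr_eq0 orbb => /orP[|/eqP //].
by rewrite eqn0Ngt mfact_gt0.
Qed.

Lemma fischerXX u w : (mdeg w < K)%N ->
  fischer 'X_[u] 'X_[w] = ((u == w) * mfact w)%N%:R.
Proof.
move=> wK; rewrite /fischer (bigD1 (BMultinom wK)) //= big1 ?addr0.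
  by rewrite !mcoeffX eqxx mulr1 natrM mulrC.
move=> u' ne; rewrite [X in _ * X]mcoeffX.
by rewrite bmeqP eq_sym in ne; rewrite (negbTE ne) mulr0.
Qed.

Lemma mfactS u i : mfact (u + U_(i))%MM = ((u i).+1 * mfact u)%N.
Proof.
rewrite /mfact (bigD1 i) //= [in RHS](bigD1 i) //= mnmDE mnm1E eqxx addn1 factS mulnA.
congr (_ * _)%N; apply: eq_bigr => j ji.
by rewrite mnmDE mnm1E eq_sym (negbTE ji) addn0.
Qed.

(** On monomials this is [mfactS]; the bound on [q] makes the truncation at [K] harmless. *)
Lemma fischerX_mderiv i p q : (msize q <= K)%N ->
  fischer ('X_i * p) q = fischer p q^`M(i).
Proof.
move=> qK; rewrite [p]mpolyE mulr_sumr !fischer_suml; apply: eq_bigr => u _.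
rewrite -scalerAr !fischerZl; congr (_ * _).
rewrite {1 2}[q]mpolyE raddf_sum /= !fischer_sumr big_seq [RHS]big_seq; apply: eq_bigr => w wq.
have wK : (mdeg w < K)%N by apply: leq_trans qK; exact: msize_mdeg_lt.
rewrite mderivZ mderivX !fischerZr; congr (_ * _).
have [wi|wi] := eqVneq (w i) 0%N.
  rewrite wi mul0r -mpolyXD (fischerXX _ wK) //; case: (eqVneq (U_(i) + u)%MM w) => // E.
  by move: wi; rewrite -E mnmDE mnm1E eqxx.
have wE : w = (w - U_(i) + U_(i))%MM by rewrite submK // lep1mP.
rewrite -mpolyXD (fischerXX _ wK) fischerXX; last by apply: leq_ltn_trans (mdegB _ _) wK.
rewrite [in LHS]wE addmC mfactS eqm_add2r -natrM mulnCA; congr (_ * (_ * _))%N%:R.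
by rewrite [in RHS]wE mnmDE mnm1E eqxx addn1.
Qed.

Lemma fischer_null p q : fischer q q = 0 -> fischer p q = 0.
Proof.
by move=> q0; rewrite /fischer big1 // => u _; rewrite (fischer_eq0 q0) ?mulr0 ?bmdeg.
Qed.

(** Gram-Schmidt along the list [us]. [Q] carries a side condition on the preimage, later a degree
    bound. The last clause is what the induction needs from the membership of [Phi x] in the span of
    the images. *)
Lemma fischer_project (U : lmodType R) (Phi : {linear U -> {mpoly R[N]}}) (Q : U -> Prop)
    (us : seq U) : Q 0 -> (forall a x y, Q x -> Q y -> Q (a *: x + y)) ->
  (forall x, x \in us -> Q x) -> forall f,
  exists x, [/\ Q x, forall y, y \in us -> fischer (f - Phi x) (Phi y) = 0
    & forall h, (forall y, y \in us -> fischer h (Phi y) = 0) -> fischer h (Phi x) = 0].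
Proof.
move=> Q0 QD; elim: us => [|x us IH] Qus f.
  by exists 0; split=> // h _; rewrite linear0 fischer0r.
have {}IH := IH (fun y yus => Qus y (@mem_behead _ (x :: us) y yus)).
have [f1 [Qf1 f1P f1span]] := IH f; have [x1 [Qx1 x1P x1span]] := IH (Phi x).
pose g := Phi x - Phi x1; pose r := f - Phi f1; pose a := fischer r g / fischer g g.
have QN y : Q y -> Q (- y) by move=> Qy; rewrite -scaleN1r -[_ *: _]addr0; exact: QD.
have PhiE : Phi (a *: (x - x1) + f1) = a *: g + Phi f1 by rewrite linearP linearB.
exists (a *: (x - x1) + f1); split.
- apply: (QD) => //; rewrite -[x]scale1r; apply: QD; last exact: QN.
  by apply: Qus; rewrite mem_head.
- have resE y : fischer (f - Phi (a *: (x - x1) + f1)) y = fischer r y - a * fischer g y.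
    rewrite PhiE opprD addrCA -/r addrC fischerDl -scaleNr fischerZl mulNr.
    by [].
  have res_us y : y \in us -> fischer (f - Phi (a *: (x - x1) + f1)) (Phi y) = 0.
    by move=> yus; rewrite resE f1P // x1P // mulr0 subr0.
  move=> y; rewrite inE => /orP[/eqP ->|]; last exact: res_us.
  have -> : Phi x = g + Phi x1 by rewrite subrK.
  rewrite fischerDr (x1span _ res_us) addr0 resE /a.
  (* The truncated form is only semi-definite; a null [g] is orthogonal to [r], so the division by
     zero in [a] does no harm. *)
  have [g0|g0] := eqVneq (fischer g g) 0; last by rewrite divfK ?subrr.
  by rewrite g0 mulr0 fischer_null ?subr0.
- move=> h hP; have h_us y : y \in us -> fischer h (Phi y) = 0.
    by move=> yus; apply: hP; rewrite inE yus orbT.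
  rewrite PhiE fischerDr fischerZr (f1span _ h_us) addr0 /g -scaleN1r fischerDr fischerZr.
  by rewrite (x1span _ h_us) hP ?mem_head // mulr0 addr0 mulr0.
Qed.

End Fischer.

(** * Polarization operators *)

Section Polarizations.
Variables (R : realType) (n m : nat).
Local Notation P := {mpoly R[m * (n + n)]}.
Local Notation J := (symp_mx R).
Implicit Types (f g : P) (i j k : 'I_m) (p q r s : 'I_(n + n)).

Definition zvar i p : P := 'X_(mxvec_index i p).
Definition yvar i r : P := \sum_p J p r *: zvar i p.
Definition dz i p f : P := f^`M(mxvec_index i p).
Definition pol r s f : P := \sum_i yvar i r * dz i s f.
(** The operator Omega_ij: [apoly i j] with each coordinate replaced by its derivative. *)
Definition contract i j f : P := \sum_p \sum_q J p q *: dz i p (dz j q f).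
Definition apoly i j : P := \sum_p \sum_q J p q *: (zvar i p * zvar j q).
(** The vector fields W_rs + W_sr span the action of the Lie algebra sp, identified with Sym^2 V. *)
Definition lie_inv f := forall r s, pol r s f + pol s r f = 0.

Lemma dz_is_linear i p : linear (dz i p).
Proof. by move=> a f g; rewrite /dz linearP. Qed.
HB.instance Definition _ i p := GRing.isLinear.Build R P P _ (dz i p) (dz_is_linear i p).

Lemma pol_is_linear r s : linear (pol r s).
Proof.
move=> a f g; rewrite /pol scaler_sumr -big_split; apply: eq_bigr => i _ /=.
by rewrite linearP mulrDr scalerAr.
Qed.
HB.instance Definition _ r s := GRing.isLinear.Build R P P _ (pol r s) (pol_is_linear r s).

Lemma contract_is_linear i j : linear (contract i j).
Proof.
move=> a f g; rewrite /contract scaler_sumr -big_split; apply: eq_bigr => p _ /=.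
rewrite scaler_sumr -big_split; apply: eq_bigr => q _ /=.
by rewrite linearD linearZ /= linearD linearZ /= scalerDr !scalerA mulrC.
Qed.
HB.instance Definition _ i j :=
  GRing.isLinear.Build R P P _ (contract i j) (contract_is_linear i j).

Lemma mxvec_index_eq i j p q :
  (mxvec_index i p == mxvec_index j q) = (i == j) && (p == q).
Proof.
apply/eqP/andP => [E|[/eqP -> /eqP ->] //].
have := congr1 (fun l => (delta_mx 0 l : 'rV[R]_(m * (n + n)))) E.
rewrite -!mxvec_delta => /(can_inj mxvecK)/matrixP/(_ i p)/eqP.
by rewrite !mxE !eqxx /=; case: (i == j); case: (p == q); rewrite //= oner_eq0.
Qed.

Lemma dz_zvar i j p q : dz i p (zvar j q) = ((i == j) && (p == q))%:R.
Proof.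
rewrite /dz /zvar mderivX mnm1E mxvec_index_eq eq_sym (eq_sym p).
case: andP => [[/eqP -> /eqP ->]|]; last by rewrite scale0r.
by rewrite -{1}[U_(_)%MM]add0m addmK mpolyX0 scale1r.
Qed.

Lemma dz_yvar i j p r : dz i p (yvar j r) = (i == j)%:R * (J p r)%:MP.
Proof.
rewrite /yvar linear_sum /=; under eq_bigr do rewrite linearZ /= dz_zvar.
rewrite (bigD1 p) //= eqxx andbT big1 ?addr0.
  by rewrite -mul_mpolyC mulrC.
by move=> q qp; rewrite [p == _]eq_sym (negbTE qp) andbF scaler0.
Qed.

Lemma dz_comm i j p q f : dz i p (dz j q f) = dz j q (dz i p f).
Proof. exact: mderiv_comm. Qed.

Lemma dzM i p f g : dz i p (f * g) = dz i p f * g + f * dz i p g.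
Proof. exact: mderivM. Qed.

Lemma dz_pol i p r s f : dz i p (pol r s f) = J p r *: dz i s f + pol r s (dz i p f).
Proof.
rewrite /pol linear_sum /=; under eq_bigr do rewrite dzM dz_yvar (dz_comm i _ p).
rewrite big_split; congr (_ + _).
rewrite (bigD1 i) //= eqxx mul1r mul_mpolyC big1 ?addr0 // => k ki.
by rewrite eq_sym (negbTE ki) !mul0r.
Qed.

Lemma symp_orth_row p q : \sum_i J p i * J q i = (p == q)%:R.
Proof.
rewrite -(symp_orth R); apply: eq_bigr => i _.
by rewrite (symp_skew R p) (symp_skew R q) mulrNN.
Qed.

Lemma sum_deltaZ (V : lmodType R) p (F : 'I_(n + n) -> V) :
  \sum_q (p == q)%:R *: F q = F p.
Proof. by rewrite -[RHS](sum_delta p F); apply: eq_bigr => q _; rewrite scaler_nat eq_sym. Qed.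

(** The commutator comes from the derivatives that hit [yvar], and J^T J = 1 collapses the sums. It
    is antisymmetric in [r] and [s], so [contract] commutes with W_rs + W_sr. *)
Lemma contract_pol i j r s f : contract i j (pol r s f) =
  pol r s (contract i j f) - dz i r (dz j s f) + dz i s (dz j r f).
Proof.
transitivity (\sum_p \sum_q (J p q * J q r) *: dz i p (dz j s f) +
  (\sum_p \sum_q (J p q * J p r) *: dz i s (dz j q f) +
   \sum_p \sum_q J p q *: pol r s (dz i p (dz j q f)))).
  rewrite -!big_split; apply: eq_bigr => p _; rewrite -!big_split; apply: eq_bigr => q _ /=.
  by rewrite dz_pol linearD linearZ /= dz_pol !scalerDr !scalerA addrA.
have -> : \sum_p \sum_q (J p q * J q r) *: dz i p (dz j s f) = - dz i r (dz j s f).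
  under eq_bigr do rewrite -scaler_suml.
  rewrite -(sum_deltaZ r (fun p => - dz i p (dz j s f))); apply: eq_bigr => p _.
  rewrite scalerN -scaleNr -symp_orth_row -sumrN; congr (_ *: _); apply: eq_bigr => q _.
  by rewrite (symp_skew R q) mulrN mulrC.
have -> : \sum_p \sum_q (J p q * J p r) *: dz i s (dz j q f) = dz i s (dz j r f).
  rewrite exchange_big -(sum_deltaZ r (fun q => dz i s (dz j q f))); apply: eq_bigr => q _.
  by rewrite -scaler_suml symp_orth eq_sym.
have -> : \sum_p \sum_q J p q *: pol r s (dz i p (dz j q f)) = pol r s (contract i j f).
  rewrite linear_sum; apply: eq_bigr => p _; rewrite linear_sum; apply: eq_bigr => q _.
  by rewrite linearZ.
by rewrite addrA addrC addrA.
Qed.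

Lemma lie_inv_contract i j f : lie_inv f -> lie_inv (contract i j f).
Proof.
move=> f_inv r s; have := linear0 (contract i j); rewrite -(f_inv r s) linearD /= !contract_pol.
by move=> <-; rewrite (dz_comm i j s) (dz_comm i j r); ring.
Qed.

Lemma lie_invB f g : lie_inv f -> lie_inv g -> lie_inv (f - g).
Proof. by move=> f_inv g_inv r s; rewrite !linearB /= addrACA -opprD f_inv g_inv subr0. Qed.

Lemma msize_dz i p f a : (msize f <= a)%N -> (msize (dz i p f) <= a.-1)%N.
Proof. exact: msize_mderiv. Qed.

Lemma msize_contract i j f a : (msize f <= a)%N -> (msize (contract i j f) <= a.-2)%N.
Proof.
move=> fa; do 2!apply: msize_sum_bound => ? _; apply: msizeZ_bound.
by do 2!apply: msize_dz.
Qed.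

Lemma msize_zvar i p : (msize (zvar i p) <= 2)%N.
Proof. by rewrite /zvar msizeX mdeg1. Qed.

Lemma msize_yvar i p : (msize (yvar i p) <= 2)%N.
Proof. by apply: msize_sum_bound => q _; apply: msizeZ_bound; exact: msize_zvar. Qed.

Lemma msize_apoly i j : (msize (apoly i j) <= 3)%N.
Proof.
do 2!apply: msize_sum_bound => ? _; apply: msizeZ_bound.
by apply: (@msizeM_bound _ _ _ _ 1 1); exact: msize_zvar.
Qed.

Lemma msize_pol r s f a : (msize f <= a.+1)%N -> (msize (pol r s f) <= a.+2)%N.
Proof.
move=> fa; apply: msize_sum_bound => i _; apply: (@msizeM_bound _ _ _ _ 1 a).
  exact: msize_yvar.
exact: leqW (msize_dz _ _ fa).
Qed.

Lemma apoly_yvar i j : \sum_s zvar i s * yvar j s = apoly j i.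
Proof.
rewrite /apoly exchange_big; apply: eq_bigr => s _; rewrite mulr_sumr; apply: eq_bigr => p _.
by rewrite -scalerAr mulrC.
Qed.

Section Energy.
Variable a : nat.
Local Notation B := (fischer a.+2).

Lemma fischer_zvar i p f g : (msize g <= a.+2)%N -> B (zvar i p * f) g = B f (dz i p g).
Proof. exact: fischerX_mderiv. Qed.

(* this compares the Casimir operators of gl and of sp *)
Lemma fischer_energy f : (msize f <= a.+1)%N -> lie_inv f ->
  \sum_r \sum_s B (pol r s f) (pol r s f) + \sum_i \sum_s B (dz i s f) (dz i s f) =
  - \sum_i \sum_j B f (apoly j i * contract i j f).
Proof.
move=> fa f_inv; have fa2 : (msize f <= a.+2)%N by exact: leqW.
(* The adjoint of y_i^r is a derivation. On [pol s r f] it hits either the factor y, which leaves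
   the diagonal term, or the derivative of [f], which builds a contraction. *)
have adj r s i : B (yvar i r * dz i s f) (pol s r f) =
    (r == s)%:R * B (dz i s f) (dz i r f) +
    \sum_j B f (zvar i s * yvar j s * \sum_p J p r *: dz j r (dz i p f)).
  rewrite /yvar mulr_suml fischer_suml.
  transitivity (\sum_p B (dz i s f) (J p r *: dz i p (pol s r f))).
    apply: eq_bigr => p _; rewrite -scalerAl fischerZl fischer_zvar ?fischerZr //.
    exact: msize_pol.
  rewrite -fischer_sumr; under eq_bigr do rewrite dz_pol scalerDr scalerA.
  rewrite big_split /= fischerDr -scaler_suml symp_orth fischerZr; congr (_ + _).
  transitivity (B (dz i s f) (\sum_j yvar j s * \sum_p J p r *: dz j r (dz i p f))).
    congr (B _ _); under eq_bigr do rewrite /pol scaler_sumr.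
    rewrite exchange_big; apply: eq_bigr => j _; rewrite mulr_sumr.
    by apply: eq_bigr => p _; rewrite scalerAr.
  rewrite fischer_sumr; apply: eq_bigr => j _.
  by rewrite -mulrA [RHS]fischerC fischer_zvar // fischerC.
(* Infinitesimal invariance replaces the square by a product of W_rs with W_sr, to which [adj]
   applies. *)
have polE r s : B (pol r s f) (pol r s f) = - B (pol r s f) (pol s r f).
  have /eqP := f_inv r s; rewrite addr_eq0 => /eqP E.
  by rewrite {2}E -scaleN1r fischerZr mulN1r.
have -> : \sum_r \sum_s B (pol r s f) (pol r s f) =
    - (\sum_i \sum_s B (dz i s f) (dz i s f)) -
    \sum_i \sum_j B f (apoly j i * contract i j f).
  transitivity (- \sum_r \sum_s \sum_i ((r == s)%:R * B (dz i s f) (dz i r f) +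
     \sum_j B f (zvar i s * yvar j s * \sum_p J p r *: dz j r (dz i p f)))).
    rewrite -sumrN; apply: eq_bigr => r _; rewrite -sumrN; apply: eq_bigr => s _.
    rewrite polE; congr (- _); rewrite {1}/pol fischer_suml.
    by apply: eq_bigr => i _; rewrite adj.
  rewrite -opprD; congr (- _).
  under eq_bigr do under eq_bigr do rewrite big_split.
  under eq_bigr do rewrite big_split.
  rewrite big_split; congr (_ + _).
    rewrite [RHS]exchange_big; apply: eq_bigr => r _ /=.
    rewrite exchange_big; apply: eq_bigr => i _ /=.
    exact: (sum_deltaZ r (fun s => B (dz i s f) (dz i r f) : R^o)).
  under eq_bigr do rewrite exchange_big.
  rewrite exchange_big; apply: eq_bigr => i _ /=.
  under eq_bigr do rewrite exchange_big.
  rewrite exchange_big; apply: eq_bigr => j _ /=.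
  have -> : contract i j f = \sum_r \sum_p J p r *: dz j r (dz i p f).
    rewrite /contract exchange_big; apply: eq_bigr => r _; apply: eq_bigr => p _.
    by rewrite dz_comm.
  rewrite -apoly_yvar mulr_sumr fischer_sumr; apply: eq_bigr => r _ /=.
  by rewrite mulr_suml fischer_sumr.
by rewrite addrAC addNr add0r.
Qed.

End Energy.

End Polarizations.

(** * Invariants *)

Section Transvection.
Variables (R : realType) (n : nat).
Implicit Types (u v w : 'cV[R]_(n + n)).

Definition transvection w (t : R) : 'M[R]_(n + n) :=
  1%:M + t *: (w *m (\row_p omega (delta_mx p 0) w)).

Lemma omega_row w u : (\row_p omega (delta_mx p 0) w) *m u = (omega u w)%:M.
Proof.
rewrite [LHS]mx11_scalar; congr (_%:M).
rewrite mxE {2}(matrix_sum_delta u) omega_suml; apply: eq_bigr => p _.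
by rewrite big_ord1 mxE mulrC -[w in RHS]scale1r omegaZ mulr1.
Qed.

Lemma transvectionE w t u : transvection w t *m u = u + (t * omega u w) *: w.
Proof.
rewrite mulmxDl mul1mx -scalemxAl -mulmxA; congr (_ + _).
by rewrite omega_row mul_mx_scalar scalerA.
Qed.

Lemma transvection_symplectic w t : symplectic (transvection w t).
Proof.
split; last first.
  move=> u v; rewrite !transvectionE omegaDl !omegaDr.
  rewrite -[v in omega (_ *: _) v]scale1r -[u in omega u (_ *: _)]scale1r !omegaZ omegavv.
  by rewrite (omega_skew w v); ring.
suff /mulmx1_unit[] : transvection w t *m transvection w (- t) = 1%:M by [].
rewrite /transvection; set r := \row_p _.
(* The rank-one part squares to zero because [omega w w] vanishes, so -t gives the inverse. *)
have ww0 : w *m r *m (w *m r) = 0.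
  by rewrite mulmxA -(mulmxA w) omega_row omegavv raddf0 mulmx0 mul0mx.
rewrite mulmxDl mul1mx -scalemxAl mulmxDr mulmx1 -scalemxAr ww0 !scaler0 addr0.
by rewrite scaleNr subrK.
Qed.

End Transvection.

(** * From group invariance to infinitesimal invariance *)

Section Invariance.
Variables (R : realType) (n m : nat).
Local Notation N := (m * (n + n))%N.
Implicit Types (f g : {mpoly R[N]}) (A : config R n m).

Lemma coordsE A i k : coords A (mxvec_index i k) = A i k 0.
Proof. by rewrite /coords mxvecE mxE. Qed.

Lemma coords_surj (v : 'I_N -> R) : exists A : config R n m, coords A =1 v.
Proof.
exists (fun i => \col_k v (mxvec_index i k)) => l.
by case/mxvec_indexP: l => i k; rewrite coordsE mxE.
Qed.

Lemma coords_fun_eq f g : (forall A : config R n m, f.@[coords A] = g.@[coords A]) -> f = g.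
Proof.
move=> fg; apply/eqP; rewrite -subr_eq0; apply/eqP/mpoly_fun_eq0 => v.
have [A Av] := coords_surj v.
by rewrite -(meval_eq _ Av) mevalB fg subrr.
Qed.

Lemma sum_mxvec_index (V : nmodType) (F : 'I_N -> V) :
  \sum_l F l = \sum_i \sum_k F (mxvec_index i k).
Proof.
by rewrite (reindex _ (curry_mxvec_bij _ _)) pair_bigA; apply: eq_bigr => -[].
Qed.

Lemma yvar_coords i r A : (@yvar R n m i r).@[coords A] = omega (A i) (delta_mx r 0).
Proof.
rewrite /yvar raddf_sum omegaE; apply: eq_bigr => p _ /=.
rewrite mevalZ mevalXU coordsE (bigD1 r) //= big1 ?addr0.
  by rewrite mxE !eqxx mulr1.
by move=> q qr; rewrite mxE (negbTE qr) !mulr0.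
Qed.

(** Under the transvections along [w] a configuration moves on a straight line, along which [f] is
    constant; its derivative at 0 is the stated sum. *)
Lemma invariant_transvection f (w : 'cV[R]_(n + n)) : invariant_fun (fun A : config R n m => f.@[coords A]) ->
  \sum_r \sum_s (w r 0 * w s 0) *: pol r s f = 0.
Proof.
move=> f_inv; apply: coords_fun_eq => A; rewrite meval0.
pose c l := coords (fun i => omega (A i) w *: w : 'cV[R]_(n + n)) l.
transitivity (\sum_l c l * f^`M(l).@[coords A]); last first.
  apply: line_const_deriv => t.
  rewrite -[RHS](f_inv _ (transvection_symplectic w t)); apply: meval_eq => l.
  case/mxvec_indexP: l => i k; rewrite /c !coordsE /diag_act transvectionE !mxE.
  by ring.
rewrite raddf_sum sum_mxvec_index /=.
under eq_bigr do rewrite raddf_sum.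
transitivity (\sum_r \sum_s \sum_i w r 0 * w s 0 *
    (omega (A i) (delta_mx r 0) * (dz i s f).@[coords A])).
  apply: eq_bigr => r _; apply: eq_bigr => s _ /=.
  rewrite mevalZ -mulr_sumr raddf_sum; congr (_ * _); apply: eq_bigr => i _ /=.
  by rewrite mevalM yvar_coords.
rewrite exchange_big [RHS]exchange_big; apply: eq_bigr => s _ /=.
rewrite exchange_big; apply: eq_bigr => i _ /=.
rewrite /c coordsE mxE [X in omega _ X](matrix_sum_delta w) omega_sumr !mulr_suml; apply: eq_bigr => r _.
rewrite big_ord1 -[A i in RHS]scale1r omegaZ /dz; ring.
Qed.

(** Polarizes the quadratic identity in [w] at sums of two basis vectors; equal vectors give
    [4 W_aa f = 0]. *)
Lemma invariant_lie f : invariant_fun (fun A : config R n m => f.@[coords A]) -> lie_inv f.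
Proof.
move=> /invariant_transvection f_inv r s.
pose q (r s : 'I_(n + n)) : 'cV[R]_(n + n) := delta_mx r 0 + delta_mx s 0.
have sumE (a b : 'I_(n + n)) (F : 'I_(n + n) -> {mpoly R[N]}) :
    \sum_p (q a b p 0) *: F p = F a + F b.
  rewrite -(sum_deltaZ a F) -(sum_deltaZ b F) -big_split; apply: eq_bigr => p _.
  by rewrite !mxE !andbT scalerDl !(eq_sym p).
have quad a b : pol a a f + pol a b f + (pol b a f + pol b b f) = 0.
  rewrite -[RHS](f_inv (q a b)); under eq_bigr => p _.
    under eq_bigr do rewrite -scalerA; rewrite -scaler_sumr sumE; over.
  by rewrite sumE.
have diag a : pol a a f = 0.
  have := quad a a; rewrite -!mulr2n -mulrnA => /eqP; rewrite -scaler_nat scaler_eq0.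
  by rewrite pnatr_eq0 => /eqP.
by have := quad r s; rewrite !diag add0r addr0.
Qed.

End Invariance.

(** * Generation of the invariants by the a_ij *)

Section FirstFundamental.
Variables (R : realType) (n m : nat).
Local Notation N := (m * (n + n))%N.
Local Notation M := #|{: symbol m}|.
Implicit Types (f : {mpoly R[N]}) (q : symb_alg R m).

Definition symb_poly (t : 'I_M) : {mpoly R[N]} :=
  apoly R n (val (enum_val t)).1 (val (enum_val t)).2.

Definition gram_poly : symb_alg R m -> {mpoly R[N]} := comp_mpoly [tuple symb_poly t | t < M].

HB.instance Definition _ := GRing.RMorphism.copy gram_poly (comp_mpoly [tuple symb_poly t | t < M]).
HB.instance Definition _ := GRing.Linear.copy gram_poly (comp_mpoly [tuple symb_poly t | t < M]).

Lemma apoly_coords i j (A : config R n m) : (apoly R n i j).@[coords A] = omega (A i) (A j).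
Proof.
rewrite /apoly raddf_sum omegaE; apply: eq_bigr => p _.
rewrite raddf_sum; apply: eq_bigr => s _ /=.
by rewrite mevalZ mevalM !mevalXU !coordsE.
Qed.

Lemma gram_poly_coords q (A : config R n m) : (gram_poly q).@[coords A] = q.@[symb_val A].
Proof.
by rewrite /gram_poly comp_mpoly_meval; apply: meval_eq => t; rewrite tnth_mktuple apoly_coords.
Qed.

Lemma gram_poly_a_sym i j : gram_poly (a_sym R i j) = apoly R n i j.
Proof. by apply: coords_fun_eq => A; rewrite gram_poly_coords a_sym_val apoly_coords. Qed.

Lemma msize_gram_poly q k : (msize q <= k.+1)%N -> (msize (gram_poly q) <= k.*2.+1)%N.
Proof.
move=> qk; rewrite /gram_poly comp_mpolyEX big_seq; apply: msize_sum_bound => u uq.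
apply: msizeZ_bound; rewrite comp_mpolyX.
apply: leq_trans (msize_prod_bound _ (a := fun i => (u i * 2)%N) _) _.
  by move=> t; apply: msizeX_bound; rewrite tnth_mktuple; exact: msize_apoly.
have := msize_mdeg_lt uq; rewrite -big_distrl /= -mdegE; lia.
Qed.

Lemma msize_a_sym (i j : 'I_m) : (msize (a_sym R i j) <= 2)%N.
Proof.
rewrite /a_sym; case: insubP => [p _ _|_]; first by rewrite msizeX mdeg1.
by case: insubP => [p _ _|_]; rewrite ?msizeN ?msizeX ?mdeg1 ?msize0.
Qed.

Lemma lie_inv_gram_poly q : lie_inv (gram_poly q).
Proof.
apply: invariant_lie => g [_ g_sp] A; rewrite !gram_poly_coords.
by apply: meval_eq => t; exact: g_sp.
Qed.

Lemma lie_inv_generated k f : (msize f <= k.*2.+1)%N -> lie_inv f ->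
  exists2 q, (msize q <= k.+1)%N & gram_poly q = f.
Proof.
elim: k f => [|k IH] f fk f_inv.
  exists (f@_0%MM)%:MP; first by rewrite msizeC; case: eqP.
  by rewrite /gram_poly comp_mpolyC -msize1_polyC.
set a := k.+1.*2 in fk *.
pose us : seq (symb_alg R m) := [seq 'X_[bmnm u] | u <- enum {: 'X_{1..M < k.+2}}].
have [|c x y xk yk|x /mapP[u _ ->]|x [xk x_us _]] :=
    @fischer_project R N a.+2 _ gram_poly (fun q => (msize q <= k.+2)%N) us _ _ _ f.
- by rewrite msize0.
- by apply: msizeD_bound => //; exact: msizeZ_bound.
- by rewrite msizeX bmdeg.
(* The part of [f] orthogonal to all polynomials of degree at most k+1 in the a_ij. *)
pose f' := f - gram_poly x.
have f'_inv : lie_inv f' by apply: lie_invB => //; exact: lie_inv_gram_poly.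
have f'k : (msize f' <= a.+1)%N.
  by apply: msizeD_bound => //; rewrite msizeN; exact: msize_gram_poly.
have f'_orth q : (msize q <= k.+2)%N -> fischer a.+2 f' (gram_poly q) = 0.
  move=> qk; rewrite (mpolywE qk) linear_sum fischer_sumr big1 // => u _.
  rewrite linearZ fischerZr x_us ?mulr0 //.
  by apply/mapP; exists u; rewrite ?mem_enum.
have energy0 : \sum_i \sum_j fischer a.+2 f' (apoly R n j i * contract i j f') = 0.
  apply: big1 => i _; apply: big1 => j _.
  (* Contraction lowers the size bound from 2k+3 to 2k+1, that of the induction hypothesis;
     multiplying back by a_ji gives degree at most k+1 in the symbols, to which [f'] is
     orthogonal. *)
  have [||q qk qE] := IH (contract i j f').
  - by have := msize_contract i j f'k.
  - exact: lie_inv_contract.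
  rewrite -qE -gram_poly_a_sym -(rmorphM gram_poly) f'_orth //.
  by apply: (@msizeM_bound _ _ _ _ 1 k); [exact: msize_a_sym|exact: qk].
have := fischer_energy f'k f'_inv; rewrite energy0 oppr0 => /eqP.
have ge0 (I J : finType) (F : I -> J -> {mpoly R[N]}) :
    0 <= \sum_i \sum_j fischer a.+2 (F i j) (F i j).
  by do 2!apply: sumr_ge0 => ? _; exact: fischer_ge0.
rewrite paddr_eq0 ?ge0 // => /andP[_ dz0].
have {}dz0 i s : fischer a.+2 (dz i s f') (dz i s f') = 0.
  move: dz0; rewrite psumr_eq0; last by move=> *; apply: sumr_ge0 => *; exact: fischer_ge0.
  move=> /allP/(_ i (mem_index_enum _))/=.
  rewrite psumr_eq0; last by move=> *; exact: fischer_ge0.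
  by move=> /allP/(_ s (mem_index_enum _))/= /eqP.
(* A coefficient of positive degree would survive in some partial derivative, and these are all
   null. *)
have f'C : (msize f' <= 1)%N.
  apply: msize_coef => u u0.
  have /mnm_neq0_ex[l ul] : u != 0%MM by rewrite -mdeg_eq0 -lt0n.
  have [ua|] := ltnP (mdeg u) a.+1; last exact: coef_msize.
  case/mxvec_indexP: l ul => i s ul.
  have uE : u = (u - U_(mxvec_index i s) + U_(mxvec_index i s))%MM by rewrite submK // lep1mP.
  have := fischer_eq0 (dz0 i s) (u := (u - U_(mxvec_index i s))%MM).
  rewrite /dz mcoeff_mderiv -uE => /(_ _)/eqP; rewrite mulrn_eq0 /= => H; apply/eqP; apply: H.
  by apply: leq_ltn_trans (mdegB _ _) _; exact: ltnW.
exists (x + (f'@_0%MM)%:MP).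
  by apply: msizeD_bound => //; rewrite msizeC; case: eqP.
by rewrite raddfD /= {2}/gram_poly comp_mpolyC -msize1_polyC // addrC subrK.
Qed.

End FirstFundamental.

(** * The algebra homomorphism on symbols *)

Section Presentation.
Variables (R : realType) (n m : nat).

Lemma symb_fun_inv (q : symb_alg R m) : (fun A => q.@[symb_val A]) \in @inv_pred R n m.
Proof.
apply/inv_predP; split; first by exists (gram_poly n q) => A; rewrite gram_poly_coords.
by move=> g [_ g_sp] A; apply: meval_eq => t; exact: g_sp.
Qed.

Definition symb_inv (q : symb_alg R m) : inv_alg R n m := InvAlg (symb_fun_inv q).

Lemma symb_inv_is_zmod_morphism : zmod_morphism symb_inv.
Proof. by move=> p q; apply/val_inj/funext => A /=; rewrite mevalB. Qed.

Lemma symb_inv_is_monoid_morphism : monoid_morphism symb_inv.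
Proof.
split=> [|p q]; apply/val_inj/funext => A /=; first by rewrite meval1.
by rewrite mevalM.
Qed.

Lemma symb_inv_is_scalable : scalable symb_inv.
Proof. by move=> c q; apply/val_inj/funext => A /=; rewrite mevalZ. Qed.

HB.instance Definition _ :=
  GRing.isZmodMorphism.Build (symb_alg R m) (inv_alg R n m) symb_inv symb_inv_is_zmod_morphism.
HB.instance Definition _ :=
  GRing.isMonoidMorphism.Build (symb_alg R m) (inv_alg R n m) symb_inv symb_inv_is_monoid_morphism.
HB.instance Definition _ :=
  GRing.isScalable.Build R (symb_alg R m) (inv_alg R n m) _ symb_inv symb_inv_is_scalable.

Lemma symb_inv_surj (f : inv_alg R n m) : exists q, symb_inv q = f.
Proof.
have /inv_predP[[p fE] f_inv] := inv_valP f.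
have p_lie : lie_inv p by apply: invariant_lie => g g_sp A; rewrite -!fE f_inv.
have [|q _ qE] := @lie_inv_generated R n m (msize p) p _ p_lie.
  by rewrite -addnn; apply: leqW; exact: leq_addr.
by exists q; apply/val_inj/funext => A /=; rewrite fE -qE gram_poly_coords.
Qed.

Lemma symb_inv_eq0 (q : symb_alg R m) :
  symb_inv q = 0 <-> forall A : config R n m, q.@[symb_val A] = 0.
Proof.
split=> [/(congr1 val) E A|q0]; first exact: (congr1 (fun h => h A) E).
by apply/val_inj/funext => A /=; exact: q0.
Qed.

End Presentation.

Theorem theorem3p1 (R : realType) (n m : nat) (hn : (1 <= n)%N) (hm : (1 <= m)%N) :
  exists phi : {lrmorphism symb_alg R m -> inv_alg R n m},
    [/\ forall i j : 'I_m, (i < j)%N -> phi (a_sym R i j) = a_inv R n i j,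
        forall f : inv_alg R n m, exists q : symb_alg R m, phi q = f
      & forall q : symb_alg R m, phi q = 0 <-> in_ideal_gen (@b_rel R m n) q].
Proof.
exists (@symb_inv R n m); split; [|exact: symb_inv_surj|].
- by move=> i j _; apply/val_inj/funext => A /=; rewrite a_sym_val.
- move=> q; split=> [/symb_inv_eq0|/relations_sound q0]; first exact: relations_complete.
  exact/symb_inv_eq0.
Qed.
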